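(* Let $\mathcal H$ and $\mathcal K$ be separable Hilbert spaces, let $A$ be a bounded self-adjoint operator on $\mathcal H$, $\mathbf B:\mathcal K\to\mathcal H$ a bounded operator, $\Gamma=\Gamma^*\in B(\mathcal K)$, and $A_\Gamma=A+\mathbf B\Gamma\mathbf B^*$. Let $\mathbf E$ and $\mathbf E_\Gamma$ be the projection-valued spectral measures of $A$ and $A_\Gamma$, and let $\mathbf M=\mathbf B^*\mathbf E\mathbf B$ and $\mathbf M^\Gamma=\mathbf B^*\mathbf E_\Gamma\mathbf B$ be the corresponding compressed spectral measures. Assume that $\mathbf M$ and $\mathbf M^\Gamma$ are weak indefinite integrals. Then their singular parts $\mathbf M_{\mathrm s}$ and $\mathbf M^\Gamma_{\mathrm s}$ satisfy the vector mutual singularity condition $$\mathbf M_{\mathrm s}\perp\Gamma\mathbf M^\Gamma_{\mathrm s}\Gamma\qquad\text{or, equivalently,}\qquad \Gamma\mathbf M_{\mathrm s}\Gamma\perp\mathbf M^\Gamma_{\mathrm s}.$$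
   Context: An operator-valued measure $\mathbf M$ on $\mathbb R$ with values in $B_+(\mathcal K)$ (non-negative bounded operators on $\mathcal K$) is a weakly countably additive function on Borel sets: $E\mapsto\langle\mathbf M(E)\mathbf x,\mathbf x\rangle$ is a finite measure for every $\mathbf x\in\mathcal K$. The compressed spectral measure is $\mathbf M(E)=\mathbf B^*\mathbf E(E)\mathbf B$. Weak indefinite integral: $\mathbf M$ is a weak indefinite integral if there exist a scalar non-negative measure $\sigma$ (a base of $\mathbf M$) and a weakly measurable function $W$ with values in $B_+(\mathcal K)$ such that $\mathbf M(E)=\int_E W(s)\,\sigma(\mathrm ds)$ for all Borel $E$, the integral understood weakly; we write $\mathbf M=W\sigma$. For a bounded measurable $B(\mathcal K)$-valued function $F$ one then sets $F^*\mathbf MF:=(F^*WF)\sigma$. Vector mutual singularity: for operator-valued measures $\mathbf M,\mathbf N$ that are both weak indefinite integrals, $\mathbf M\perp\mathbf N$ means that there exists a measurable operator-valued function $\Pi$ on $\mathbb R$, whose values are orthogonal projections in $\mathcal K$, such that $\Pi\mathbf M\Pi=\mathbf 0$ and $(\mathbf I-\Pi)\mathbf N(\mathbf I-\Pi)=\mathbf 0$. Singular parts: let $\mu$ be a scalar spectral measure of maximal spectral type of $A$ (i.e. $\mu=\langle\mathbf E(\cdot)\mathbf x,\mathbf x\rangle$ for some $\mathbf x\in\mathcal H$ such that $\langle\mathbf E(\cdot)\mathbf y,\mathbf y\rangle\ll\mu$ for all $\mathbf y\in\mathcal H$), with Lebesgue decomposition $\mu=\mu_{\mathrm{ac}}+\mu_{\mathrm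 s}$ with respect to Lebesgue measure, and let $S$ be a Borel set of Lebesgue measure zero with $\mu_{\mathrm s}(\mathbb R\setminus S)=0$. Then $\mathbf E_{\mathrm s}(E):=\mathbf E(E\cap S)$ (independent of the choices) and $\mathbf M_{\mathrm s}:=\mathbf B^*\mathbf E_{\mathrm s}\mathbf B$; $\mathbf M^\Gamma_{\mathrm s}$ is defined in the same way from $A_\Gamma$. *)

(* Defs.v *)
From HB Require Import structures.
From mathcomp Require Import all_boot all_order all_algebra.
From mathcomp.real_closed Require Import complex.
From mathcomp Require Import all_classical all_reals all_analysis.
From mathcomp Require Import ring lra.

Set Implicit Arguments.
Unset Strict Implicit.
Unset Printing Implicit Defensive.

Import Order.TTheory GRing.Theory Num.Theory.
Import numFieldNormedType.Exports.

Local Open Scope classical_set_scope.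
Local Open Scope ring_scope.
Local Open Scope complex_scope.

(* As for the forms of sesquilinear.v, the inner product is linear in its
   first argument and conjugate-linear in its second one. *)
HB.mixin Record CompleteNormedModule_isHilbert (R : realType) (H : Type)
    & CompleteNormedModule R[i] H := {
  inner : {dot H for (@Num.conj R[i])} ;
  inner_norm : forall x : H, inner x x = `|x| ^+ 2 }.

#[short(type="hilbertType")]
HB.structure Definition Hilbert (R : realType) :=
  {H of CompleteNormedModule R[i] H & CompleteNormedModule_isHilbert R H}.

Notation "''[' u , v ]" := (inner u%R v%R) : ring_scope.

Definition separable (T : topologicalType) :=
  exists2 D : set T, countable D & dense D.

Section InnerTheory.
Variables (R : realType) (H : hilbertType R).
Implicit Types x y z : H.

Lemma innerC x y : '[x, y] = Num.conj '[y, x].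
Proof. by rewrite hermC expr0 mul1r. Qed.

Lemma inner_inj x y : (forall z, '[z, x] = '[z, y]) -> x = y.
Proof.
move=> xy; apply/eqP; rewrite -subr_eq0 -(dnorm_eq0 inner).
by rewrite linearBr [X in X - _]xy subrr.
Qed.

Lemma inner_sub x y (t : R[i]) : '[x - t *: y, x - t *: y] =
  '[x, x] - (t * '[y, x] + Num.conj (t * '[y, x])) + `|t| ^+ 2 * '[y, y].
Proof.
rewrite dnormB dnormZ linearZr_LR /= rmorphM/= conjCK -innerC rmorphM/= -innerC.
by ring.
Qed.

Lemma CauchySchwarz_inner x y : `|'[x, y]| <= `|x| * `|y|.
Proof.
have [->|y0] := eqVneq y 0; first by rewrite linear0r !normr0 mulr0.
have n0 : 0 < `|y| ^+ 2 by rewrite exprn_gt0 // normr_gt0.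
rewrite -(ler_pXn2r (n := 2)) ?nnegrE ?mulr_ge0 // exprMn.
have := dnorm_ge0 inner (x - ('[x, y] / `|y| ^+ 2) *: y).
rewrite inner_sub !inner_norm.
have -> : '[x, y] / `|y| ^+ 2 * '[y, x] = `|'[x, y]| ^+ 2 / `|y| ^+ 2.
  by rewrite mulrAC (innerC y x) -normCK.
have -> : Num.conj (`|'[x, y]| ^+ 2 / `|y| ^+ 2) = `|'[x, y]| ^+ 2 / `|y| ^+ 2.
  by apply/CrealP; rewrite realE divr_ge0 // exprn_ge0.
have -> : `|'[x, y] / `|y| ^+ 2| ^+ 2 * `|y| ^+ 2 = `|'[x, y]| ^+ 2 / `|y| ^+ 2.
  rewrite normrM normfV (ger0_norm (ltW n0)) exprMn exprVn -mulrA.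
  by congr (_ * _); rewrite [X in X^-1]expr2 invfM -mulrA mulVf ?mulr1 // gt_eqF.
set w := _ / _; rewrite (_ : _ + w = `|x| ^+ 2 - w); last by ring.
by rewrite subr_ge0 ler_pdivrMr.
Qed.

End InnerTheory.

Section Riesz.
Variables (R : realType) (H : hilbertType R).
Implicit Types x y z : H.

Let N x : R := complex.Re `|x|.

Let normN x : `|x| = (N x)%:C.
Proof. by rewrite /N RRe_real // normr_real. Qed.

Let N_ge0 x : 0 <= N x.
Proof. by rewrite -ler0c -normN. Qed.

Let N_triangle x y : N (x + y) <= N x + N y.
Proof. by rewrite -lecR rmorphD /= -!normN ler_normD. Qed.

Let N_sub x y : N (x - y) ^+ 2 = 2 * N x ^+ 2 + 2 * N y ^+ 2 - N (x + y) ^+ 2.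
Proof.
apply: complexI; rewrite !(rmorphB, rmorphD, rmorphM, rmorphXn) /= -!normN.
rewrite -!expr2 -!inner_norm dnormB dnormD -[1%:C]/(1 : R[i]).
by ring.
Qed.

Let NZ (t : R) x : 0 <= t -> N (t%:C *: x) = t * N x.
Proof.
move=> t0; apply: complexI; rewrite rmorphM /= -!normN normrZ.
by rewrite ger0_norm // ler0c.
Qed.

Lemma Riesz (f : H -> R[i]) : (forall a x y, f (a *: x + y) = a * f x + f y) ->
  (exists C, forall x, `|f x| <= C * `|x|) -> exists y, forall x, f x = '[x, y].
Proof.
move=> flin [C fC].
have f0 : f 0 = 0 by have := fC 0; rewrite normr0 mulr0 normr_le0 => /eqP.
have fD x y : f (x + y) = f x + f y by rewrite -[x]scale1r flin mul1r scale1r.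
have fZ a x : f (a *: x) = a * f x by rewrite -[a *: x]addr0 flin f0 addr0.
have fB x y : f (x - y) = f x - f y by rewrite fD -scaleN1r fZ mulN1r.
have [feq0|] := pselect (forall x, f x = 0).
  by exists 0 => x; rewrite feq0 linear0r.
move=> /existsNP[x1 /eqP fx1].
have fx0 : f ((f x1)^-1 *: x1) = 1 by rewrite fZ mulVf.
pose S := N @` [set x | f x = 1].
have infS : has_inf S.
  split; first by exists (N ((f x1)^-1 *: x1)); exists ((f x1)^-1 *: x1).
  by exists 0 => _ [x _ <-].
have dle x : f x = 1 -> inf S <= N x.
  by move=> fx; apply: ge_inf; [case: infS|exists x].
set d := inf S in dle *.
have d0 : 0 <= d by apply: lb_le_inf; [case: infS|move=> _ [x _ <-]].
have uP n : exists x, f x = 1 /\ N x < d + n.+1%:R^-1.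
  have [_ [x fx <-] xd] := @inf_adherent _ S n.+1%:R^-1 ltac:(by rewrite invr_gt0) infS.
  by exists x.
have [u {}uP] := choice uP.
have par n m (e : R) : 0 <= e -> e <= 1 -> n.+1%:R^-1 <= e -> m.+1%:R^-1 <= e ->
    N (u n - u m) ^+ 2 <= (8 * d + 4) * e.
  move=> e0 e1 ne me.
  have [fn un] := uP n; have [fm um] := uP m.
  have h : 2 * d <= N (u n + u m).
    have := dle ((2^-1)%:C *: (u n + u m)); rewrite NZ ?invr_ge0 // => /(_ _).
    have -> : f ((2^-1)%:C *: (u n + u m)) = 1.
      rewrite fZ fD fn fm -(rmorph1 (real_complex R)) -rmorphD -rmorphM /=.
      by congr (_%:C); field.
    by move=> /(_ erefl); rewrite ler_pdivlMl.
  rewrite N_sub.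
  have hn : N (u n) ^+ 2 <= (d + e) ^+ 2.
    by rewrite ler_pXn2r ?nnegrE ?addr_ge0 // (le_trans (ltW un)) // lerD2l.
  have hm : N (u m) ^+ 2 <= (d + e) ^+ 2.
    by rewrite ler_pXn2r ?nnegrE ?addr_ge0 // (le_trans (ltW um)) // lerD2l.
  have h2 : (2 * d) ^+ 2 <= N (u n + u m) ^+ 2.
    by rewrite ler_pXn2r ?nnegrE ?mulr_ge0.
  nra.
have invle (e : R) : 0 < e -> exists n, forall m, (n <= m)%N -> m.+1%:R^-1 <= e.
  move=> e0; exists (Num.truncn e^-1) => m nm.
  rewrite -[e]invrK lef_pV2 ?posrE ?invr_gt0 //.
  apply: ltW; rewrite (lt_le_trans (truncnS_gt _)) // ler_nat ltnS //.
have ucvg : cvg (u @ \oo).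
  apply/cauchy_cvgP/cauchy_exP => eps eps0.
  have -> : eps = (complex.Re eps)%:C by rewrite RRe_real // gtr0_real.
  have {}eps0 : 0 < complex.Re eps by move: eps0; rewrite ltcE => /andP[].
  set e := complex.Re eps in eps0 *.
  pose e' := Num.min 1 (e ^+ 2 / (8 * d + 5)).
  have k0 : 0 < 8 * d + 5 by lra.
  have e'0 : 0 < e' by rewrite lt_min ltr01 divr_gt0 // exprn_gt0.
  have [n hn] := invle _ e'0.
  exists (u n); suff: \forall m \near \oo, ball (u n) e%:C (u m) by [].
  near=> m; rewrite -ball_normE /= normN ltcR.
  have : N (u n - u m) ^+ 2 <= (8 * d + 4) * e'.
    apply: par; rewrite ?(ltW e'0) ?hn //; first by rewrite ge_min lexx.
    by near: m; exists n.
  have : (8 * d + 5) * e' <= e ^+ 2.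
    by rewrite mulrC -ler_pdivlMr // ge_min lexx orbT.
  move=> h1 h2; rewrite -(ltr_pXn2r (n := 2)) ?nnegrE ?(ltW eps0) //.
  by nra.
pose z := lim (u @ \oo).
have uz (e : R) : 0 < e -> exists n, N (z - u n) < e /\ n.+1%:R^-1 <= e.
  move=> e0; have [n hn] := invle _ e0.
  have /cvgrPdist_lt/(_ e%:C) : u @ \oo --> z by [].
  rewrite ltcR => /(_ e0) [k _ hk]; exists (maxn n k); split.
    by rewrite -ltcR -normN hk //= leq_maxr.
  by apply: hn; rewrite leq_maxl.
have fz : f z = 1.
  apply/eqP; rewrite -subr_eq0 -normr_eq0; apply: contraT => fz1.
  pose a := complex.Re `|f z - 1|; pose c := complex.Re `|C|.
  have aE : `|f z - 1| = a%:C by rewrite RRe_real // normr_real.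
  have cE : `|C| = c%:C by rewrite RRe_real // normr_real.
  have a0 : 0 < a by rewrite -ltcR -aE lt_def fz1 normr_ge0.
  have c0 : 0 <= c by rewrite -ler0c -cE.
  have [n [zn _]] := uz (a / (c + 1)) ltac:(by rewrite divr_gt0 // ltr_wpDl).
  have ac : a <= c * N (z - u n).
    rewrite -lecR rmorphM /= -aE -cE -normN -(uP n).1 -fB.
    rewrite (le_trans (fC _)) // (le_trans (real_ler_norm _)) ?normrM ?normr_id //.
    by apply: ger0_real; rewrite (le_trans _ (fC _)).
  move: zn; rewrite ltr_pdivlMr ?ltr_wpDl // => zn.
  have := lt_le_trans zn ac.
  by rewrite mulrDr mulr1 mulrC gtrDl ltNge N_ge0.
have zd : N z <= d.
  apply/ler_addgt0Pr => e e0; have [n [zn ne]] := uz (e / 2) ltac:(by rewrite divr_gt0).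
  have [_ un] := uP n.
  have := N_triangle (z - u n) (u n); rewrite subrK => /le_trans; apply.
  rewrite [e]splitr addrCA lerD ?(ltW zn) //.
  by rewrite (le_trans (ltW un)) // lerD2l.
have orth v : f v = 0 -> '[v, z] = 0.
  move=> fv; apply/eqP; rewrite -normr_eq0; apply: contraT => vz0.
  pose w := complex.Re `|'[v, z]|.
  have wE : `|'[v, z]| = w%:C by rewrite RRe_real // normr_real.
  have w0 : 0 < w by rewrite -ltcR -wE lt_def vz0 normr_ge0.
  pose s := (1 + N v ^+ 2)^-1.
  have s0 : 0 < s by rewrite invr_gt0 ltr_pwDl // exprn_ge0.
  have sv : s * (1 + N v ^+ 2) = 1.
    by rewrite mulVf // gt_eqF // ltr_pwDl // exprn_ge0.
  pose t := s%:C * Num.conj '[v, z].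
  have zt : d <= N (z - t *: v) by apply: dle; rewrite fB fZ fv mulr0 subr0.
  have tE : t * '[v, z] = (s * w ^+ 2)%:C.
    by rewrite /t -mulrA (mulrC (Num.conj _)) -normCK wE rmorphM rmorphXn.
  have tN : `|t| = (s * w)%:C.
    by rewrite /t normrM norm_conjC wE ger0_norm ?ler0c ?(ltW s0) // rmorphM.
  have : N (z - t *: v) ^+ 2 = N z ^+ 2 - 2 * (s * w ^+ 2) + (s * w) ^+ 2 * N v ^+ 2.
    apply: complexI; rewrite rmorphXn /= -normN -inner_norm inner_sub tE tN.
    have -> : Num.conj (s * w ^+ 2)%:C = (s * w ^+ 2)%:C.
      by apply/CrealP; rewrite complex_real.
    rewrite !inner_norm !normN -!rmorphXn -!rmorphD -rmorphM -rmorphB -rmorphD /=.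
    by congr (_%:C); ring.
  have : N z ^+ 2 <= N (z - t *: v) ^+ 2.
    by rewrite ler_pXn2r ?nnegrE // (le_trans zd).
  move=> h1 h2; have w2 : 0 < s * w ^+ 2 by rewrite mulr_gt0 // exprn_gt0.
  have : (s * w) ^+ 2 * N v ^+ 2 = s * w ^+ 2 * (1 - s).
    by rewrite -[X in X - s]sv; ring.
  by suff : s * w ^+ 2 < 0; [rewrite ltNge ltW|nra].
have z0 : '[z, z] != 0.
  rewrite dnorm_eq0; apply/eqP => z0; move: fz; rewrite z0 f0 => /esym/eqP.
  by rewrite oner_eq0.
exists (Num.conj ('[z, z]^-1) *: z) => x.
have : f (x - f x *: z) = 0 by rewrite fB fZ fz mulr1 subrr.
move=> /orth; rewrite linearBl linearZl_LR /= => /eqP; rewrite subr_eq0 => /eqP xz.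
by rewrite linearZr_LR /= conjCK xz mulrC -mulrA mulfV // mulr1.
Unshelve. all: by end_near. Qed.

End Riesz.

Section BoundedOperators.
Variable R : realType.

Record boundedOp (H K : hilbertType R) := BoundedOp {
  op_fun :> {linear H -> K} ;
  op_continuous : continuous op_fun }.

Lemma op_bound (H K : hilbertType R) (T : boundedOp H K) :
  exists2 C, 0 < C & forall x, `|T x| <= C * `|x|.
Proof.
have /linear_bounded_continuous/linear_boundedP := @op_continuous _ _ T.
by move=> /pinfty_ex_gt0[C C0 hC]; exists C.
Qed.

Lemma op_of_bound (H K : hilbertType R) (f : {linear H -> K}) (C : R[i]) :
  0 < C -> (forall x, `|f x| <= C * `|x|) -> continuous f.
Proof.
move=> C0 fC; apply/linear_bounded_continuous/linear_boundedP.
near=> r => x; rewrite (le_trans (fC x)) // ler_wpM2r //.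
by near: r; apply: nbhs_pinfty_ge; rewrite gtr0_real.
Unshelve. all: by end_near. Qed.

Section Composition.
Variables (H K L : hilbertType R) (T : boundedOp K L) (U : boundedOp H K).

Let comp_lin : {linear H -> L} := T \o U.

Let comp_continuous : continuous comp_lin.
Proof.
by move=> x; apply: continuous_comp; exact: op_continuous.
Qed.

Definition op_comp : boundedOp H L := BoundedOp comp_continuous.
End Composition.

Section Complement.
Variables (H : hilbertType R) (T : boundedOp H H).

Let compl_lin : {linear H -> H} := idfun \- T.

Let compl_continuous : continuous compl_lin.
Proof. by move=> x; apply: cvgB; [exact: cvg_id|exact: op_continuous]. Qed.

Definition op_compl : boundedOp H H := BoundedOp compl_continuous.
End Complement.

Section Adjoint.
Variables (H K : hilbertType R) (B : boundedOp H K).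

Lemma adjoint_exists :
  exists C : boundedOp K H, forall x y, '[B x, y] = '[x, C y].
Proof.
have [b b0 hb] := op_bound B.
have /choice[C hC] : forall y, exists z, forall x, '[B x, y] = '[x, z].
  move=> y; apply: (@Riesz _ _ (fun x => '[B x, y])).
    by move=> a u v; rewrite linearP linearDl linearZl_LR.
  exists (b * `|y|) => x; rewrite (le_trans (CauchySchwarz_inner _ _)) //.
  by rewrite -mulrA (mulrC `|y|) mulrA ler_wpM2r /=.
have Clin : linear C.
  move=> a u v; apply: inner_inj => x.
  by rewrite -hC !linearDr/= !linearZr_LR/= !hC.
pose Cl := GRing.isLinear.Build _ _ _ _ C Clin.
pose Cm : {linear K -> H} := HB.pack C Cl.
suff cC : continuous Cm by exists (BoundedOp cC).
apply: (op_of_bound b0) => y /=.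
have [->|Cy0] := eqVneq (C y) 0; first by rewrite normr0 mulr_ge0 // ltW.
rewrite -(ler_pM2l (x := `|C y|)) ?normr_gt0 //.
rewrite -expr2 -inner_norm -hC.
have := dnorm_ge0 inner (C y); rewrite -hC => /ger0_norm <-.
rewrite (le_trans (CauchySchwarz_inner _ _)) // mulrA ler_wpM2r //.
by rewrite mulrC.
Qed.

Definition adj : boundedOp K H := sval (cid adjoint_exists).

Lemma adjP x y : '[B x, y] = '[x, adj y].
Proof. by rewrite /adj; case: cid. Qed.
End Adjoint.

Definition selfadjoint (H : hilbertType R) (T : boundedOp H H) :=
  forall x y, '[T x, y] = '[x, T y].

Definition positive_op (H : hilbertType R) (T : boundedOp H H) :=
  forall x, 0 <= '[T x, x].

Definition orthogonal_projection (H : hilbertType R) (T : boundedOp H H) :=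
  selfadjoint T /\ forall x, T (T x) = T x.

End BoundedOperators.

Section OperatorMeasures.
Variable R : realType.

(* As for the library's measures, only the values on Borel sets matter;
   nonnegativity is imposed on all sets for convenience. *)
Record opMeasure (H : hilbertType R) := OpMeasure {
  om_val :> set (measurableTypeR R) -> boundedOp H H ;
  om_set0 : forall x, om_val set0 x = 0 ;
  om_ge0 : forall S, positive_op (om_val S) ;
  om_sigma_additive : forall x,
    semi_sigma_additive (fun S => (complex.Re '[om_val S x, x])%:E) }.

Section ScalarMeasure.
Variables (H : hilbertType R) (M : opMeasure H) (x : H).

(* Taking the real part loses nothing: <M(S) x, x> is real, as M(S) >= 0. *)
Definition scalar_measure (S : set (measurableTypeR R)) : \bar R :=
  (complex.Re '[M S x, x])%:E.

Let scalar_measure0 : scalar_measure set0 = 0%E.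
Proof. by rewrite /scalar_measure om_set0 linear0l. Qed.

Let scalar_measure_ge0 S : (0 <= scalar_measure S)%E.
Proof.
by rewrite lee_fin; have := om_ge0 M S x; rewrite lecE => /andP[].
Qed.

HB.instance Definition _ := isMeasure.Build _ _ _ scalar_measure
  scalar_measure0 scalar_measure_ge0 (@om_sigma_additive _ M x).

End ScalarMeasure.

Section Restriction.
Variables (H : hilbertType R) (M : opMeasure H).
Variables (S : set (measurableTypeR R)) (mS : measurable S).

Definition om_restr_val X := M (X `&` S).

Let restr_set0 x : om_restr_val set0 x = 0.
Proof. by rewrite /om_restr_val set0I om_set0. Qed.

Let restr_ge0 X : positive_op (om_restr_val X).
Proof. exact: om_ge0. Qed.

Let restr_sigma_additive x :
  semi_sigma_additive (fun X => (complex.Re '[om_restr_val X x, x])%:E).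
Proof.
exact: (@measure_semi_sigma_additive _ _ _ (mrestr (scalar_measure M x) mS)).
Qed.

Definition om_restr :=
  OpMeasure restr_set0 restr_ge0 restr_sigma_additive.
End Restriction.

Section Compression.
Variables (H K : hilbertType R) (B : boundedOp K H) (M : opMeasure H).

Definition compress_val X := op_comp (adj B) (op_comp (M X) B).

Let compressE X x : '[compress_val X x, x] = '[M X (B x), B x].
Proof. by rewrite innerC -adjP -innerC. Qed.

Let compress_set0 x : compress_val set0 x = 0.
Proof. by rewrite /= om_set0 linear0. Qed.

Let compress_ge0 X : positive_op (compress_val X).
Proof. by move=> x; rewrite compressE om_ge0. Qed.

Let compress_sigma_additive x :
  semi_sigma_additive (fun X => (complex.Re '[compress_val X x, x])%:E).
Proof.
under eq_fun do rewrite compressE.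
exact: om_sigma_additive.
Qed.

Definition compress :=
  OpMeasure compress_set0 compress_ge0 compress_sigma_additive.
End Compression.

(* The last clause is A = \int t E(dt) in quadratic-form sense; by polarization
   it is the weak operator integral. *)
Definition spectral_measure (H : hilbertType R) (A : H -> H)
    (E : opMeasure H) :=
  [/\ forall X, measurable X -> orthogonal_projection (E X),
      forall x, E setT x = x,
      forall X Y, measurable X -> measurable Y ->
        forall x, E (X `&` Y) x = E X (E Y x)
    & forall x,
        (scalar_measure E x).-integrable setT (EFin : R -> \bar R) /\
        '[A x, x] = (Rintegral (scalar_measure E x) setT id)%:C].

Definition mutually_singular (m n : set (measurableTypeR R) -> \bar R) :=
  exists2 X, measurable X & m X = 0%E /\ n (~` X) = 0%E.

Definition Lebesgue_decomposition
    (m mac ms : {measure set (measurableTypeR R) -> \bar R}) :=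
  [/\ forall X, measurable X -> m X = (mac X + ms X)%E,
      mac `<< @lebesgue_measure R
    & mutually_singular ms (@lebesgue_measure R)].

Definition maximal_spectral_type (H : hilbertType R) (E : opMeasure H) (x : H) :=
  forall y, scalar_measure E y `<< scalar_measure E x.

(* S is a Lebesgue-null Borel set carrying the singular part of a scalar
   spectral measure of maximal type. *)
Definition singular_carrier (H : hilbertType R) (E : opMeasure H)
    (S : set (measurableTypeR R)) :=
  [/\ measurable S, @lebesgue_measure R S = 0%E
    & exists x (mac ms : {measure set (measurableTypeR R) -> \bar R}),
      [/\ maximal_spectral_type E x,
          Lebesgue_decomposition (scalar_measure E x) mac ms
        & ms (~` S) = 0%E]].

Section SingularPart.
Variables (H : hilbertType R) (E : opMeasure H).
Variables (S : set (measurableTypeR R)) (cS : singular_carrier E S).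

Let carrier_measurable : measurable S.
Proof. by case: cS. Qed.

(* The values on Borel sets do not depend on the choice of S. *)
Definition singular_part := om_restr E carrier_measurable.
End SingularPart.

(* On a separable space this is also strong (pointwise) measurability. *)
Definition weakly_measurable (K : hilbertType R)
    (F : measurableTypeR R -> boundedOp K K) :=
  forall x y, measurable_fun setT (fun s => complex.Re '[F s x, y]) /\
              measurable_fun setT (fun s => complex.Im '[F s x, y]).

Definition is_cintegral (m : {measure set (measurableTypeR R) -> \bar R})
    (X : set (measurableTypeR R)) (f : measurableTypeR R -> R[i]) (c : R[i]) :=
  [/\ m.-integrable X (fun s => (complex.Re (f s))%:E),
      m.-integrable X (fun s => (complex.Im (f s))%:E)
    & c = Rintegral m X (fun s => complex.Re (f s)) +i*
          Rintegral m X (fun s => complex.Im (f s))].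

Definition is_weak_integral (K : hilbertType R)
    (N : set (measurableTypeR R) -> K -> K)
    (F : measurableTypeR R -> K -> K)
    (m : {measure set (measurableTypeR R) -> \bar R}) :=
  forall X, measurable X ->
  forall x y, is_cintegral m X (fun s => '[F s x, y]) '[N X x, y].

Definition has_density (K : hilbertType R) (M : opMeasure K)
    (W : measurableTypeR R -> boundedOp K K)
    (m : {measure set (measurableTypeR R) -> \bar R}) :=
  [/\ weakly_measurable W, forall s, positive_op (W s)
    & is_weak_integral (fun X => M X) (fun s => W s) m].

Definition weak_indefinite_integral (K : hilbertType R) (M : opMeasure K) :=
  exists W m, has_density M W m.

(* N = F^* M F, meaning N = (F^* W F) m where M = W m; on a separable space
   N does not depend on the representation M = W m. *)
Definition is_sandwich (K : hilbertType R)
    (F : measurableTypeR R -> boundedOp K K) (M : opMeasure K)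
    (N : set (measurableTypeR R) -> K -> K) :=
  exists W m, has_density M W m /\
    is_weak_integral N (fun s => adj (F s) \o W s \o F s) m.

Definition vector_mutually_singular (K : hilbertType R) (M N : opMeasure K) :=
  [/\ weak_indefinite_integral M, weak_indefinite_integral N
    & exists P : measurableTypeR R -> boundedOp K K,
      [/\ weakly_measurable P,
          forall s, orthogonal_projection (P s),
          is_sandwich P M (fun _ => \0)
        & is_sandwich (fun s => op_compl (P s)) N (fun _ => \0)]].

End OperatorMeasures.

(* Main.v *)
From HB Require Import structures.
Require Import Defs.
From mathcomp Require Import all_boot all_order all_algebra.
From mathcomp.real_closed Require Import complex.
From mathcomp Require Import all_classical all_reals all_analysis.
From mathcomp Require Import ring lra.

Import Order.TTheory GRing.Theory Num.Theory.
Import numFieldNormedType.Exports.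

Local Open Scope classical_set_scope.
Local Open Scope ring_scope.

Set Implicit Arguments.
Unset Strict Implicit.
Unset Printing Implicit Defensive.

(* The spectral subspace of A for a set X inside [c - r, c + r] is invariant
   under A, and A - c has norm at most r on it; the same holds for A_Gamma.
   Since B Gamma B^* = A_Gamma - A, this gives the local estimate
     |<Gamma M(X) x, M^Gamma(X) y>| <= 2 r (<M(X) x, x> <M^Gamma(X) y, y>)^(1/2).
   Write M = W m and M^Gamma = W' m', and let X be a Lebesgue null set on which
   W x and W' y are almost constant, close to a and b with <Gamma a, b> <> 0.
   On the pieces of X the left-hand side is comparable to the product of the
   masses given by m and m', and the right-hand side to r times the square root
   of that product, so on each interval one of the two masses is O(r).  Covering
   X by intervals of small total length splits X into an m-null and an m'-null
   part.  Hence, up to such null sets, W Gamma W' = 0 on the Lebesgue null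
   carriers of the singular parts, and the projection onto the kernel of the
   first density separates the two measures.  No common base measure is
   needed. *)

(** * The real part of the inner product and the real-valued norm *)

Section RealInnerProduct.
Context {R : realType} {H : hilbertType R}.
Implicit Types (x y z : H) (t : R).
Local Open Scope complex_scope.

(** Real values open the estimates to [lra] and [nra]. The imaginary part is not lost: [Im_inner]
    recovers it by replacing [y] with ['i *: y]. *)
Definition rin x y : R := complex.Re '[x, y].
Definition nrm x : R := complex.Re `|x|.

Lemma nrmE x : `|x| = (nrm x)%:C.
Proof. by rewrite /nrm RRe_real // normr_real. Qed.

Lemma nrm_ge0 x : 0 <= nrm x.
Proof. by rewrite -ler0c -nrmE. Qed.

Lemma nrm0 : nrm 0 = 0.
Proof. by rewrite /nrm normr0. Qed.

Lemma nrm_eq0 x : nrm x = 0 -> x = 0.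
Proof. by move=> x0; apply/eqP; rewrite -normr_eq0 nrmE x0. Qed.

Lemma rinC x y : rin x y = rin y x.
Proof. by rewrite /rin innerC; case: (inner y x). Qed.

Lemma rinDl x y z : rin (x + y) z = rin x z + rin y z.
Proof. by rewrite /rin linearDl raddfD. Qed.

Lemma rinBl x y z : rin (x - y) z = rin x z - rin y z.
Proof. by rewrite /rin linearBl raddfB. Qed.

Lemma rinZl t x y : rin (t%:C *: x) y = t * rin x y.
Proof. by rewrite /rin linearZl_LR /=; case: '[x, y] => a b /=; rewrite mul0r subr0. Qed.

Lemma rinDr x y z : rin x (y + z) = rin x y + rin x z.
Proof. by rewrite rinC rinDl !(rinC x). Qed.

Lemma rinBr x y z : rin x (y - z) = rin x y - rin x z.
Proof. by rewrite rinC rinBl !(rinC x). Qed.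

Lemma rinZr t x y : rin x (t%:C *: y) = t * rin x y.
Proof. by rewrite rinC rinZl (rinC x). Qed.

Lemma rin0l x : rin 0 x = 0.
Proof. by rewrite -(subrr x) rinBl subrr. Qed.

Lemma rin0r x : rin x 0 = 0.
Proof. by rewrite rinC rin0l. Qed.

Lemma rinxx x : rin x x = nrm x ^+ 2.
Proof. by rewrite /rin inner_norm nrmE -rmorphXn. Qed.

Lemma Im_inner x y : complex.Im '[x, y] = rin x ('i *: y).
Proof.
by rewrite /rin linearZr_LR /=; case: '[x, y] => a b /=; rewrite mul0r sub0r mulN1r opprK.
Qed.

Lemma CauchySchwarz_rin x y : `|rin x y| <= nrm x * nrm y.
Proof.
rewrite -lecR rmorphM /= -!nrmE (le_trans _ (CauchySchwarz_inner x y)) //.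
exact: normc_ge_Re.
Qed.

Lemma rin_le x y : rin x y <= nrm x * nrm y.
Proof. exact: le_trans (ler_norm _) (CauchySchwarz_rin x y). Qed.

Lemma nrmD x y : nrm (x + y) <= nrm x + nrm y.
Proof. by rewrite -lecR rmorphD /= -!nrmE ler_normD. Qed.

Lemma nrmN x : nrm (- x) = nrm x.
Proof. by rewrite /nrm normrN. Qed.

Lemma nrmC x y : nrm (x - y) = nrm (y - x).
Proof. by rewrite -nrmN opprB. Qed.

Lemma nrmZ t x : nrm (t%:C *: x) = `|t| * nrm x.
Proof.
apply: complexI; rewrite rmorphM /= -!nrmE normrZ; congr (_ * _).
by rewrite normc_def /= expr0n /= addr0 sqrtr_sqr.
Qed.

Lemma nrmD2 x y : nrm (x + y) ^+ 2 = nrm x ^+ 2 + 2 * rin x y + nrm y ^+ 2.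
Proof. by rewrite -!rinxx rinDl !rinDr (rinC y x); ring. Qed.

Lemma nrmB2 x y : nrm (x - y) ^+ 2 = nrm x ^+ 2 - 2 * rin x y + nrm y ^+ 2.
Proof. by rewrite -!rinxx rinBl !rinBr (rinC y x); ring. Qed.

Lemma rin_inj x y : (forall z, rin z x = rin z y) -> x = y.
Proof.
move=> xy; apply/subr0_eq/nrm_eq0/eqP; rewrite -sqrf_eq0 -rinxx rinBr.
by rewrite xy subrr.
Qed.

Lemma inner_eq0 x y : rin x y = 0 -> rin x ('i *: y) = 0 -> '[x, y] = 0.
Proof.
by rewrite -Im_inner /rin; case: '[x, y] => a b /= -> ->.
Qed.

End RealInnerProduct.

(** * Bounded, self-adjoint and positive operators in terms of [rin] and [nrm] *)

Section BoundedOperators.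
Context {R : realType}.
Local Open Scope complex_scope.

Lemma nrm_bound {H K : hilbertType R} (T : boundedOp H K) :
  exists2 C : R, 0 < C & forall x, nrm (T x) <= C * nrm x.
Proof.
have [C C0 hC] := op_bound T.
have CE : C = (complex.Re C)%:C by rewrite RRe_real // gtr0_real.
exists (complex.Re C) => [|x]; first by rewrite -ltcR -CE.
by rewrite -lecR rmorphM /= -CE -!nrmE.
Qed.

Lemma nrm_continuous {H K : hilbertType R} (f : {linear H -> K}) (C : R) :
  0 < C -> (forall x, nrm (f x) <= C * nrm x) -> continuous f.
Proof.
move=> C0 fC; apply: (@op_of_bound _ _ _ _ C%:C); first by rewrite ltcR.
by move=> x; rewrite !nrmE -rmorphM /= lecR.
Qed.

Lemma adj_rin {H K : hilbertType R} (B : boundedOp H K) x y :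
  rin (B x) y = rin x (adj B y).
Proof. by rewrite /rin adjP. Qed.

Context {H : hilbertType R}.
Implicit Type T : boundedOp H H.

Lemma selfadjoint_rin T : selfadjoint T -> forall x y, rin (T x) y = rin x (T y).
Proof. by move=> sT x y; rewrite /rin sT. Qed.

Lemma selfadjoint_adj T x : selfadjoint T -> adj T x = T x.
Proof. by move=> sT; apply: inner_inj => z; rewrite -adjP sT. Qed.

Lemma rin_selfadjoint T : (forall x y, rin (T x) y = rin x (T y)) -> selfadjoint T.
Proof.
move=> sT x y; have := sT x ('i *: y); rewrite linearZ /= -!Im_inner.
by have := sT x y; rewrite /rin; case: '[T x, y] '[x, T y] => ? ? [? ?] /= -> ->.
Qed.

(** Complex polarization: the form is real at [x], [y] and [x + 'i *: y], and its vanishing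
    imaginary part at the last vector equates the real parts of <T x, y> and <x, T y>. *)
Lemma positive_selfadjoint T : positive_op T -> selfadjoint T.
Proof.
move=> T0.
have im x : complex.Im '[T x, x] = 0.
  by have := T0 x; rewrite lecE => /andP[/eqP].
apply: rin_selfadjoint => x y.
have := im (x + 'i *: y); rewrite linearD /= linearZ /=.
rewrite !(linearDl, linearDr) /= !raddfD /= !im add0r.
rewrite !linearZl_LR !linearZr_LR /= /rin (innerC x (T y)).
have := im y.
case: '[T x, y] '[T y, y] '[T y, x] => a b [c d] [e f] /= ->.
by move=> h; lra.
Qed.

Lemma positive_op_rin T x : positive_op T -> 0 <= rin (T x) x.
Proof. by move=> /(_ x); rewrite lecE => /andP[]. Qed.

End BoundedOperators.

Lemma scalar_measureE {R : realType} {H : hilbertType R} (M : opMeasure H) x X :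
  scalar_measure M x X = (rin (M X x) x)%:E.
Proof. by []. Qed.

Lemma integrable_cst {d} {T : measurableType d} {R : realType}
    (m : {measure set T -> \bar R}) X (k : R) :
  measurable X -> (m X < +oo)%E -> m.-integrable X (EFin \o cst k).
Proof.
move=> mX Xoo; apply: measurable_bounded_integrable => //.
exact: bounded_cst.
Qed.

(** * Localization: [T] is close to a scalar on the spectral subspace of a small set *)

Section SpectralLocalization.
Context {R : realType} {H : hilbertType R} (T : {linear H -> H}) (E : opMeasure H).
Context (symT : forall x y, rin (T x) y = rin x (T y)).
Context (specT : spectral_measure T E).
Local Open Scope complex_scope.

Lemma spectral_proj X x y : measurable X -> rin (E X x) y = rin x (E X y).
Proof. by case: specT => + _ _ _ => /[apply] -[sE _]; exact: selfadjoint_rin. Qed.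

Lemma spectral_idem X x : measurable X -> E X (E X x) = E X x.
Proof. by case: specT => + _ _ _ => /[apply] -[_]. Qed.

Lemma spectralI X Y x : measurable X -> measurable Y -> E X (E Y x) = E (X `&` Y) x.
Proof. by case: specT => _ _ EI _ mX mY; rewrite EI. Qed.

Lemma spectral_norm X x : measurable X -> nrm (E X x) ^+ 2 = rin (E X x) x.
Proof. by move=> mX; rewrite -rinxx spectral_proj// spectral_idem// rinC. Qed.

Lemma spectral_quad x : rin (T x) x = Rintegral (scalar_measure E x) setT id.
Proof. by rewrite /rin; case: specT => _ _ _ /(_ x)[_ ->]. Qed.

Lemma spectral_integrable x :
  (scalar_measure E x).-integrable setT (EFin : measurableTypeR R -> \bar R).
Proof. by case: specT => _ _ _ /(_ x)[]. Qed.

(** The cross terms <E(Y) u, v> vanish, so the scalar spectral measure of [u + v] is the sum of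
    those of [u] and [v]. Integrating t makes the form of [T] additive on [u + v], and by symmetry
    its cross term is twice the real part of <T u, v>. *)
Lemma spectral_orthogonal X u v : measurable X -> E X u = u -> E X v = 0 ->
  rin (T u) v = 0.
Proof.
move=> mX Xu Xv.
have cross Y : measurable Y -> rin (E Y u) v = 0.
  move=> mY; rewrite -Xu spectralI// setIC -spectralI// spectral_proj//.
  by rewrite Xv rin0r.
have mD Y : measurable Y -> scalar_measure E (u + v) Y =
    measure_add (scalar_measure E u) (scalar_measure E v) Y.
  move=> mY; rewrite measure_addE !scalar_measureE -EFinD; congr EFin.
  rewrite linearD /= rinDl !rinDr (cross Y mY) (spectral_proj v)// (rinC v).
  by rewrite (cross Y mY) addr0 add0r.
have : rin (T (u + v)) (u + v) = rin (T u) u + rin (T v) v.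
  rewrite !spectral_quad /Rintegral.
  rewrite (eq_measure_integral (measure_add (scalar_measure E u) (scalar_measure E v)));
    last by move=> Y mY _; exact: mD.
  rewrite integral_measure_add//; [|exact: spectral_integrable..].
  by rewrite fineD//; apply: integrable_fin_num => //; exact: spectral_integrable.
rewrite linearD /= rinDl !rinDr (symT v u) (rinC v); lra.
Qed.

(** The vector [T u - E X (T u)] is killed by [E X], hence orthogonal to [T u] by
    [spectral_orthogonal] and to the range of [E X], and so to itself. *)
Lemma spectral_range X u : measurable X -> E X u = u -> E X (T u) = T u.
Proof.
move=> mX Xu; apply/esym/subr0_eq/nrm_eq0/eqP; rewrite -sqrf_eq0 -rinxx.
have Xw : E X (T u - E X (T u)) = 0 by rewrite linearB /= spectral_idem// subrr.
by rewrite rinBl (spectral_orthogonal mX)// spectral_proj// Xw rin0r subrr.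
Qed.

(** The scalar spectral measure of [u] is carried by [X], with mass [nrm u ^+ 2], and t stays
    between c - r and c + r there. *)
Lemma spectral_form_bound (X : set (measurableTypeR R)) (c r : R) u : measurable X ->
  (forall t : R, X t -> `|t - c| <= r) -> E X u = u ->
  `|rin (T u) u - c * nrm u ^+ 2| <= r * nrm u ^+ 2.
Proof.
move=> mX Xr Xu.
have nu : nrm u ^+ 2 = fine (scalar_measure E u X).
  by rewrite -[in LHS]Xu spectral_norm.
have nX : scalar_measure E u (~` X) = 0%E.
  rewrite scalar_measureE -[X in rin _ X]Xu -spectral_proj//.
  rewrite spectralI//; last exact: measurableC.
  rewrite setICr /rin om_set0 linear0l//.
have iX : (scalar_measure E u).-integrable X (EFin : measurableTypeR R -> \bar R).
  exact: integrableS (spectral_integrable u).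
have iC (k : R) : (scalar_measure E u).-integrable X (EFin \o cst k).
  by apply: integrable_cst; rewrite // ltry.
have Tu : rin (T u) u = Rintegral (scalar_measure E u) X id.
  rewrite spectral_quad /Rintegral (@negligible_integral _ _ _ _ setT (~` X))//.
  - by rewrite setTD setCK.
  - exact: measurableC.
  - exact: spectral_integrable.
have le1 : rin (T u) u <= (c + r) * nrm u ^+ 2.
  rewrite Tu nu -Rintegral_cst//; apply: (le_Rintegral mX iX (iC _)) => t /Xr.
  by rewrite ler_distl => /andP[].
have le2 : (c - r) * nrm u ^+ 2 <= rin (T u) u.
  rewrite Tu nu -Rintegral_cst//; apply: (le_Rintegral mX (iC _) iX) => t /Xr.
  by rewrite ler_distl => /andP[].
by rewrite ler_distl; apply/andP; split; move: le1 le2; rewrite mulrBl mulrDl; lra.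
Qed.

(** The norm of a symmetric operator is controlled by its quadratic form. This applies to T - c on
    the range of [E X], which is invariant by [spectral_range]. *)
Lemma spectral_local_bound (X : set (measurableTypeR R)) (c r : R) u : measurable X ->
  (forall t : R, X t -> `|t - c| <= r) -> E X u = u ->
  nrm (T u - c%:C *: u) <= r * nrm u.
Proof.
move=> mX Xr Xu; set Tc := fun x : H => T x - c%:C *: x.
have q x : E X x = x -> `|rin (Tc x) x| <= r * nrm x ^+ 2.
  by move=> Xx; rewrite /Tc rinBl rinZl rinxx; exact: (spectral_form_bound mX Xr Xx).
have XTu : E X (Tc u) = Tc u by rewrite /Tc linearB linearZ /= spectral_range// Xu.
have TD x y : Tc (x + y) = Tc x + Tc y.
  by rewrite /Tc linearD /= scalerDr opprD addrACA.
have TB x y : Tc (x - y) = Tc x - Tc y.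
  by rewrite /Tc linearB /= scalerBr !opprD addrACA.
have sT x y : rin (Tc x) y = rin (Tc y) x.
  by rewrite /Tc !(rinBl, rinZl) symT (rinC x y) (rinC x (T y)).
(* Polarization with v := s Tc u, where s balances the norms of u and v. *)
have main (s : R) : 2 * s * nrm (Tc u) ^+ 2 <= r * (nrm u ^+ 2 + s ^+ 2 * nrm (Tc u) ^+ 2).
  set v := s%:C *: Tc u.
  have Xv : E X v = v by rewrite linearZ /= XTu.
  have XD : E X (u + v) = u + v by rewrite linearD /= Xu Xv.
  have XB : E X (u - v) = u - v by rewrite linearB /= Xu Xv.
  move: (q _ XD) (q _ XB).
  rewrite TB TD nrmB2 nrmD2 rinBl rinDl !rinBr !rinDr (sT v u).
  have -> : rin (Tc u) v = s * nrm (Tc u) ^+ 2 by rewrite rinZr rinxx.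
  have -> : nrm v ^+ 2 = s ^+ 2 * nrm (Tc u) ^+ 2.
    by rewrite nrmZ exprMn real_normK ?num_real.
  rewrite !ler_norml => /andP[h1 h2] /andP[h3 h4]; lra.
have [/nrm_eq0 u0|u0] := eqVneq (nrm u) 0.
  by rewrite u0 linear0 scaler0 subr0 nrm0 mulr0.
have u1 : 0 < nrm u by rewrite lt_neqAle eq_sym u0 nrm_ge0.
rewrite -/(Tc u); have [Tu0|Tu0] := eqVneq (nrm (Tc u)) 0.
  (* Only the sign of [r] is at stake here, and [s = 0] yields it. *)
  by have := main 0; rewrite Tu0; nra.
have := main (nrm u / nrm (Tc u)).
rewrite expr_div_n divfK ?expf_neq0//.
have -> : 2 * (nrm u / nrm (Tc u)) * nrm (Tc u) ^+ 2 = 2 * nrm u * nrm (Tc u).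
  by field.
by move=> h; rewrite -(ler_pM2l u1); nra.
Qed.

End SpectralLocalization.

(** * The local estimate for the perturbed pair *)

Lemma perturbation_bound {R : realType} {H K : hilbertType R}
    (A : boundedOp H H) (B : boundedOp K H) (G : boundedOp K K) (E EG : opMeasure H)
    (X : set (measurableTypeR R)) (c r : R) x y :
  selfadjoint A -> selfadjoint G ->
  spectral_measure A E -> spectral_measure (A \+ (B \o G \o adj B)) EG ->
  measurable X -> (forall t : R, X t -> `|t - c| <= r) ->
  `|rin (G (compress B E X x)) (compress B EG X y)| <=
    2 * r * (nrm (E X (B x)) * nrm (EG X (B y))).
Proof.
move=> /selfadjoint_rin sA /selfadjoint_rin sG specE specEG mX Xr.
set u := E X (B x); set v := EG X (B y).
pose AG : {linear H -> H} := A \+ (B \o G \o adj B).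
have sAG z w : rin (AG z) w = rin z (AG w).
  rewrite /AG /= rinDl rinDr sA; congr (_ + _).
  by rewrite adj_rin sG rinC -adj_rin rinC.
have Eu : E X u = u by rewrite /u (spectral_idem specE).
have Ev : EG X v = v by rewrite /v (spectral_idem (T := AG) specEG).
have hu := spectral_local_bound sA specE mX Xr Eu.
have hv := spectral_local_bound (T := AG) sAG specEG mX Xr Ev.
(* Moving [B] across turns the left-hand side into the real part of <u, (AG - A) v>. Inserting c on
   both sides leaves two terms, each at most [r * nrm u * nrm v]. *)
have -> : rin (G (compress B E X x)) (compress B EG X y) =
    rin u (AG v - c%:C%C *: v) - rin (A u - c%:C%C *: u) v.
  rewrite -[compress B E X x]/(adj B u) -[compress B EG X y]/(adj B v) -adj_rin.
  rewrite rinBr rinBl rinZl rinZr -sAG /AG /= rinDl; ring.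
have h1 := le_trans (CauchySchwarz_rin u (AG v - c%:C%C *: v)) (ler_wpM2l (nrm_ge0 u) hv).
have h2 := le_trans (CauchySchwarz_rin (A u - c%:C%C *: u) v) (ler_wpM2r (nrm_ge0 v) hu).
by rewrite (le_trans (ler_normB _ _))//; move: h1 h2; lra.
Qed.

Lemma compress_rin {R : realType} {H K : hilbertType R} (T : {linear H -> H})
    (B : boundedOp K H) (E : opMeasure H) X x :
  spectral_measure T E -> measurable X ->
  nrm (E X (B x)) ^+ 2 = rin (compress B E X x) x.
Proof.
by move=> specE mX; rewrite (spectral_norm specE)// rinC adj_rin rinC.
Qed.

(** * Lebesgue null sets: covers of small length and the splitting by two measures *)

Lemma Lebesgue_null_cover {R : realType} (X : set (measurableTypeR R)) (e : R) :
  lebesgue_measure X = 0%E -> 0 < e ->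
  exists c r : nat -> R, [/\ forall k, 0 <= r k,
    forall t : R, X t -> exists k, `|t - c k| <= r k
  & (\sum_(k <oo) (r k)%:E <= e%:E)%E].
Proof.
move=> X0 e0; move: (X0).
(* Unfolded, Lebesgue measure is an infimum over countable covers by half-open intervals; it is 0
   here, so some cover has total length below [e]. *)
rewrite /lebesgue_measure /lebesgue_stieltjes_measure /measure_extension /mu_ext.
set S := (X in ereal_inf X) => h.
have [|_ [F [mF XF] <-]] := @lb_ereal_inf_adherent _ S e e0.
  by rewrite h.
rewrite h add0e => Fe.
have /choice[cr crP] : forall k, exists p : R * R, [/\ 0 <= p.2,
    forall t, F k t -> `|t - p.1| <= p.2 & (p.2%:E <= wlength idfun (F k))%E].
  move=> k; have /ocitvP[->|[[a b] /= ab ->]] := mF k.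
    by exists (0, 0); split => //; rewrite wlength0.
  exists ((a + b) / 2, (b - a) / 2); split => /=; first by lra.
    move=> t /=; rewrite in_itv /= => /andP[at_ tb].
    by rewrite ler_distl; apply/andP; split; lra.
  rewrite wlength_itv /= lte_fin ab -EFinB lee_fin; lra.
exists (fun k => (cr k).1), (fun k => (cr k).2); split.
- by move=> k; case: (crP k).
- by move=> t /XF[k _ Fkt]; exists k; case: (crP k) => _ + _; exact.
- apply: le_trans (ltW Fe); apply: lee_nneseries => k _.
    by rewrite lee_fin; case: (crP k).
  by case: (crP k).
Qed.

(* The sum of the lengths controls m on the good intervals and m' on the
   others, so that Borel-Cantelli applies to both. *)
Lemma singular_split {R : realType} (m m' : {measure set (measurableTypeR R) -> \bar R})
    (X : set (measurableTypeR R)) (k : R) :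
  measurable X -> lebesgue_measure X = 0%E -> 0 <= k ->
  (forall (Y : set (measurableTypeR R)) (c r : R), measurable Y -> Y `<=` X -> 0 <= r ->
    (forall t : R, Y t -> `|t - c| <= r) ->
    (m Y <= (k * r)%:E \/ m' Y <= (k * r)%:E)%E) ->
  exists Y Z, [/\ measurable Y, measurable Z, m Y = 0%E, m' Z = 0%E & X `<=` Y `|` Z].
Proof.
move=> mX X0 k0 hX.
(* Stage n uses a cover of total radius at most [e n]. These bounds sum to 1, so the masses of the
   stages are summable. *)
pose e n : R := 1 / (2 ^ n.+1)%:R.
have e0 n : 0 < e n by rewrite divr_gt0// ltr0n expn_gt0.
have /choice[c cP] n := Lebesgue_null_cover X0 (e0 n).
have /choice[r rP] := cP.
pose I n i := X `&` [set t : measurableTypeR R | `|(t : R) - c n i| <= r n i].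
have mI n i : measurable (I n i).
  apply: measurableI => //.
  rewrite (_ : [set _ | _] = `[c n i - r n i, c n i + r n i]%classic).
    exact: measurable_itv.
  by apply/seteqP; split => t /=; rewrite in_itv /= ler_distl.
pose F (p : {measure set (measurableTypeR R) -> \bar R}) n :=
  \bigcup_(i in [set i | (p (I n i) <= (k * r n i)%:E)%E]) I n i.
have mF p n : measurable (F p n) by exact: bigcup_measurable.
have Fe (p : {measure set (measurableTypeR R) -> \bar R}) n : (p (F p n) <= (k * e n)%:E)%E.
  (* Rejected indices contribute the empty set, so that subadditivity can run over all natural
     numbers. *)
  pose J i := if pselect ((p (I n i) <= (k * r n i)%:E)%E) then I n i else set0.
  have [r0 _ re] := rP n.
  apply: (@le_trans _ _ (\sum_(i <oo) p (J i))%E).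
    apply: measure_sigma_subadditive => //.
      move=> i; rewrite /J; case: (pselect (_ <= _)%E) => ? /=; first exact: mI.
      exact: measurable0.
    by move=> t [i /= pi It]; exists i => //; rewrite /J; case: (pselect (_ <= _)%E).
  apply: (@le_trans _ _ (\sum_(i <oo) (k%:E * (r n i)%:E))%E).
    apply: lee_nneseries => i _ //; rewrite /J; case: (pselect (_ <= _)%E) => ? //=.
    by rewrite measure0 -EFinM lee_fin mulr_ge0.
  rewrite nneseriesZl; last by move=> i _; rewrite lee_fin.
  by rewrite EFinM lee_wpmul2l// lee_fin.
have F0 (p : {measure set (measurableTypeR R) -> \bar R}) : p (lim_sup_set (F p)) = 0%E.
  apply: lim_sup_set_cvg0 => //.
  apply: (@le_lt_trans _ _ (\sum_(n <oo) (k%:E * (e n)%:E))%E).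
    by apply: lee_nneseries => n _ //; rewrite -EFinM.
  rewrite nneseriesZl; last by move=> n _; rewrite lee_fin ltW.
  rewrite (@le_lt_trans _ _ (k%:E * 1%:E)%E)// ?ltry//.
  by apply: lee_wpmul2l; [rewrite lee_fin|exact: epsilon_trick0].
have mL p : measurable (lim_sup_set (F p)).
  by apply: bigcap_measurable => // n _; exact: bigcup_measurable.
exists (lim_sup_set (F m)), (lim_sup_set (F m')); split => // t Xt.
have tF n : F m n t \/ F m' n t.
  have [r0 /(_ _ Xt)[i ti] _] := rP n.
  have It : I n i t by [].
  have [||//|||] := hX (I n i) (c n i) (r n i) => //; [by move=> ? []|by move=> ? []|left|right];
    by exists i.
(* A point outside the first limsup avoids every [F m j] from some n on, so by [tF] it lies in
   [F m' j] for all those j. *)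
have [tm|/existsNP[n /not_implyP [_ tm]]] := pselect (lim_sup_set (F m) t); [by left|right].
move=> j _; exists (maxn n j) => /=; first exact: leq_maxr.
by have [Ft|//] := tF (maxn n j); case: tm; exists (maxn n j) => //=; exact: leq_maxl.
Qed.

(** * Operator densities on sets where they are almost constant *)

Section Density.
Context {R : realType}.
Local Notation borel := (set (measurableTypeR R)).

Lemma Rintegral_le_cst (m : {measure set (measurableTypeR R) -> \bar R})
    (X : borel) (f : R -> R) (k : R) :
  measurable X -> (m X < +oo)%E -> m.-integrable X (EFin \o f) ->
  (forall s, X s -> f s <= k) -> Rintegral m X f <= k * fine (m X).
Proof.
move=> mX Xoo fi fk; rewrite -Rintegral_cst//.
by apply: (le_Rintegral mX fi) => //; exact: integrable_cst.
Qed.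

(** Markov's inequality. It is needed because the base measure of a density may be infinite. *)
Lemma integrable_ge_cst_lty (m : {measure set (measurableTypeR R) -> \bar R})
    (X : borel) (f : R -> R) (k : R) :
  measurable X -> 0 < k -> m.-integrable X (EFin \o f) ->
  (forall s, X s -> k <= f s) -> (m X < +oo)%E.
Proof.
move=> mX k0 fi fk.
rewrite -(@lte_pmul2l _ k%:E) ?lte_fin// mulry gtr0_sg// mul1e -integral_cst//.
apply: le_lt_trans (integral_fune_lt_pinfty mX fi); apply: ge0_le_integral => //.
- by move=> s _; rewrite lee_fin ltW.
- exact: measurable_int fi.
Qed.

Section OneDensity.
Context {K : hilbertType R} (M : opMeasure K) (W : measurableTypeR R -> boundedOp K K).
Context (m : {measure set (measurableTypeR R) -> \bar R}) (dM : has_density M W m).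

Lemma density_integrable X x y : measurable X ->
  m.-integrable X (EFin \o (fun s => rin (W s x) y)).
Proof. by case: dM => _ _ iM mX; have [] := iM X mX x y. Qed.

Lemma density_rin X x y : measurable X ->
  rin (M X x) y = Rintegral m X (fun s => rin (W s x) y).
Proof. by case: dM => _ _ iM mX; have [_ _ +] := iM X mX x y; rewrite /rin => ->. Qed.

(** Testing the difference [v] against itself gives the integral of <W x - a, v>, whose integrand
    has real part at most [eta * nrm v]. *)
Lemma density_approx (X : borel) x a (eta : R) : measurable X -> (m X < +oo)%E ->
  (forall s, X s -> nrm (W s x - a) <= eta) ->
  nrm (M X x - (fine (m X))%:C%C *: a) <= eta * fine (m X).
Proof.
move=> mX Xoo Wa; set v := _ - _.
have : nrm v ^+ 2 <= (eta * fine (m X)) * nrm v.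
  rewrite -rinxx {1}/v rinBl rinZl density_rin//.
  rewrite lerBlDr (_ : _ + _ = (eta * nrm v + rin a v) * fine (m X)); last by ring.
  apply: Rintegral_le_cst => //; first exact: density_integrable.
  move=> s /Wa Ws; rewrite -lerBlDr -rinBl (le_trans (rin_le _ _))//.
  by rewrite ler_wpM2r// nrm_ge0.
have [->|v0] := eqVneq (nrm v) 0.
  (* No sign is assumed for [eta]: a point of [X] forces it to be nonnegative, and an empty [X] has
     mass 0. *)
  move=> _; have [->|/set0P[s /Wa]] := eqVneq X set0; first by rewrite measure0 mulr0.
  by move=> /(le_trans (nrm_ge0 _)) h; rewrite mulr_ge0 ?fine_ge0.
by rewrite expr2 ler_pM2r// lt_neqAle eq_sym v0 nrm_ge0.
Qed.

Lemma density_form_le (X : borel) x (C : R) : measurable X -> (m X < +oo)%E ->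
  (forall s, X s -> rin (W s x) x <= C) -> rin (M X x) x <= C * fine (m X).
Proof.
move=> mX Xoo WC; rewrite density_rin//; apply: Rintegral_le_cst => //.
exact: density_integrable.
Qed.

(** The real part of <W x, a> is at least |a| (|a| - eta), which is positive, so Markov's inequality
    applies. *)
Lemma density_lty (X : borel) x a (eta : R) : measurable X -> eta < nrm a ->
  (forall s, X s -> nrm (W s x - a) <= eta) -> (m X < +oo)%E.
Proof.
move=> mX etaa Wa.
have [->|/set0P[s0 /Wa s0X]] := eqVneq X set0; first by rewrite measure0.
have eta0 := le_trans (nrm_ge0 _) s0X.
apply: (@integrable_ge_cst_lty m X (fun s => rin (W s x) a) (nrm a * (nrm a - eta))) => //.
- by rewrite mulr_gt0 ?subr_gt0// (le_lt_trans eta0).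
- exact: density_integrable.
- move=> s /Wa Ws; rewrite -[W s x](subrK a) rinDl rinxx.
  have := CauchySchwarz_rin (W s x - a) a; rewrite ler_norml => /andP[+ _].
  by have := ler_wpM2r (nrm_ge0 a) Ws; lra.
Qed.

End OneDensity.

Context {H K : hilbertType R} {A : boundedOp H H} {B : boundedOp K H} {G : boundedOp K K}.
Context {E EG : opMeasure H} (selfA : selfadjoint A) (selfG : selfadjoint G).
Context (specE : spectral_measure A E).
Context (specEG : spectral_measure (A \+ (B \o G \o adj B)) EG).
Context {W W' : measurableTypeR R -> boundedOp K K}.
Context {m m' : {measure set (measurableTypeR R) -> \bar R}}.
Context (dM : has_density (compress B E) W m) (dMG : has_density (compress B EG) W' m').

(** The hypothesis on [g], [eta], [a] and [b] says that <G a, b> survives all errors made by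
    replacing the densities with the constants [a] and [b]. Then [perturbation_bound] supplies the
    alternative required by [singular_split]. *)
Lemma density_piece (X : borel) x y a b (eta C g : R) :
  measurable X -> lebesgue_measure X = 0%E -> 0 <= C ->
  0 <= eta -> 0 < g -> (forall z, nrm (G z) <= g * nrm z) ->
  g * eta * (nrm a + nrm b + eta) < `|rin (G a) b| ->
  (forall s, X s -> [/\ nrm (W s x - a) <= eta, nrm (W' s y - b) <= eta,
    rin (W s x) x <= C & rin (W' s y) y <= C]) ->
  exists Y Z, [/\ measurable Y, measurable Z, m Y = 0%E, m' Z = 0%E & X `<=` Y `|` Z].
Proof.
move=> mX X0 C0 eta0 g0 hG gap hX.
have Gle u v : `|rin (G u) v| <= g * nrm u * nrm v.
  by rewrite (le_trans (CauchySchwarz_rin _ _))// ler_wpM2r ?nrm_ge0.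
(* If [nrm a] or [nrm b] were at most [eta], the error term would already exceed
   [g * nrm a * nrm b], hence the main term. *)
have [a0 b0] : eta < nrm a /\ eta < nrm b.
  have := lt_le_trans gap (Gle a b); have := nrm_ge0 a; have := nrm_ge0 b.
  rewrite -!mulrA ltr_pM2l// => ? ? ?; split; nra.
have mXoo : (m X < +oo)%E by apply: (density_lty dM (x := x) mX a0) => s /hX[].
have m'Xoo : (m' X < +oo)%E by apply: (density_lty dMG (x := y) mX b0) => s /hX[].
(* What is left of |<G a, b>| after the two cross errors and the product of both errors, per unit of
   [al * be]. *)
set k0 := `|rin (G a) b| - g * eta * (nrm a + nrm b + eta).
have k00 : 0 < k0 by rewrite subr_gt0.
have K0 : 0 <= 2 * C / k0 by rewrite divr_ge0 ?mulr_ge0// ltW.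
apply: (singular_split mX X0 K0) => Y c r mY YX r0 Yr.
have Yoo (p : {measure set (measurableTypeR R) -> \bar R}) : (p X < +oo)%E -> (p Y < +oo)%E.
  by apply: le_lt_trans; apply: le_measure; rewrite ?inE.
have mYoo := Yoo m mXoo; have m'Yoo := Yoo m' m'Xoo.
(* If both masses exceeded [2 * C / k0 * r], so would the square root of their product, against the
   bounds [lower] and [upper] below. *)
apply: contrapT => /not_orP[/negP + /negP]; rewrite -!ltNge.
rewrite -[m Y]fineK ?ge0_fin_numE// -[m' Y]fineK ?ge0_fin_numE// !lte_fin.
set al := fine (m Y); set be := fine (m' Y) => alr ber.
set p := compress B E Y x - al%:C%C *: a; set q := compress B EG Y y - be%:C%C *: b.
have hp : nrm p <= eta * al by apply: (density_approx dM) => // s /YX /hX[].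
have hq : nrm q <= eta * be by apply: (density_approx dMG) => // s /YX /hX[].
have kr0 : 0 <= 2 * C / k0 * r by rewrite mulr_ge0// divr_ge0 ?mulr_ge0// ltW.
have al0 : 0 < al by exact: le_lt_trans alr.
have be0 : 0 < be by exact: le_lt_trans ber.
have lower : al * be * k0 <= `|rin (G (compress B E Y x)) (compress B EG Y y)|.
  rewrite -[compress B E Y x](subrK (al%:C%C *: a)) -/p.
  rewrite -[compress B EG Y y](subrK (be%:C%C *: b)) -/q.
  clearbody p q; rewrite linearD linearZ /= rinDl !rinDr !rinZl !rinZr.
  have h1 : `|rin (G a) q| <= g * nrm a * (eta * be).
    by rewrite (le_trans (Gle _ _))// ler_wpM2l// mulr_ge0 ?nrm_ge0// ltW.
  have h2 : `|rin (G p) b| <= g * (eta * al) * nrm b.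
    by rewrite (le_trans (Gle _ _))// ler_wpM2r ?nrm_ge0// ler_wpM2l// ltW.
  have h3 : `|rin (G p) q| <= g * (eta * al) * (eta * be).
    rewrite (le_trans (Gle _ _))// ler_pM ?nrm_ge0 ?mulr_ge0 ?nrm_ge0// ?(ltW g0)//.
    by rewrite ler_wpM2l// ltW.
  set t := rin (G a) b.
  set t1 := rin (G a) q in h1 *; set t2 := rin (G p) b in h2 *; set t3 := rin (G p) q in h3 *.
  have -> : t3 + be * t2 + (al * t1 + al * (be * t)) =
    al * be * t - (- (al * t1 + be * t2 + t3)) by ring.
  apply: le_trans (lerB_dist _ _); rewrite !normrM normrN (gtr0_norm al0) (gtr0_norm be0).
  have : `|al * t1 + be * t2 + t3| <= al * `|t1| + be * `|t2| + `|t3|.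
    rewrite (le_trans (ler_normD _ _))// lerD2r (le_trans (ler_normD _ _))//.
    by rewrite !normrM (gtr0_norm al0) (gtr0_norm be0).
  have h1' := ler_wpM2l (ltW al0) h1; have h2' := ler_wpM2l (ltW be0) h2.
  by rewrite /k0 -/t => h; lra.
have upper := perturbation_bound x y selfA selfG specE specEG mY Yr.
have := @compress_rin _ _ _ A B E Y x specE mY.
pose AG : {linear H -> H} := A \+ (B \o G \o adj B).
have := @compress_rin _ _ _ AG B EG Y y specEG mY.
set N := nrm (E Y (B x)) in upper *; set N' := nrm (EG Y (B y)) in upper *.
move=> N'E NE.
have N2 : N ^+ 2 <= C * al.
  by rewrite NE; apply: (density_form_le dM) => // s /YX /hX[].
have N'2 : N' ^+ 2 <= C * be.
  by rewrite N'E; apply: (density_form_le dMG) => // s /YX /hX[].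
have lu := le_trans lower upper.
have NN : (N * N') ^+ 2 <= C ^+ 2 * (al * be).
  by rewrite exprMn (_ : C ^+ 2 * _ = (C * al) * (C * be)); [rewrite ler_pM ?sqr_ge0|ring].
have ab0 : 0 < al * be by rewrite mulr_gt0.
(* Squaring avoids the square root of [al * be], and one factor [al * be] then cancels. *)
have sq : (al * be * k0) ^+ 2 <= (2 * r) ^+ 2 * (C ^+ 2 * (al * be)).
  apply: (@le_trans _ _ ((2 * r * (N * N')) ^+ 2)).
    by rewrite ler_pXn2r ?nnegrE ?(le_trans _ lu)// ?mulr_ge0// ltW.
  by rewrite exprMn ler_wpM2l// sqr_ge0.
have sq' : al * be * k0 ^+ 2 <= (2 * r) ^+ 2 * C ^+ 2.
  by rewrite -(ler_pM2l ab0); move: sq; rewrite !exprMn; lra.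
have : (2 * C / k0 * r) ^+ 2 < al * be by rewrite expr2 ltr_pM.
rewrite -(ltr_pM2r (x := k0 ^+ 2)) ?exprn_gt0//.
rewrite (_ : _ * k0 ^+ 2 = (2 * r) ^+ 2 * C ^+ 2); first by lra.
by field; rewrite gt_eqF.
Qed.

End Density.

(** * Dense sequences and the measurability of norms *)

Section Separable.
Context {R : realType} {K : hilbertType R}.

Lemma dense_sequence : separable K ->
  exists d : nat -> K, forall x (e : R), 0 < e -> exists k, nrm (x - d k) < e.
Proof.
move=> [D cD dD].
have near_D x (e : R) : 0 < e -> exists2 y, D y & nrm (x - y) < e.
  move=> e0; have [||y [xy Dy]] := dD (ball x e%:C%C).
  - by exists x; apply: ballxx; rewrite ltcR.
  - exact: ball_open.
  by exists y => //; move: xy; rewrite -ball_normE /= nrmE ltcR.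
have /pfcard_geP[D0|[d]] := cD.
  by have [y] := near_D 0 1 ltr01; rewrite D0.
exists d => x e /(near_D x)[y Dy xy].
by have [k _ dk] := 'surj_d Dy; exists k; rewrite dk.
Qed.

Context (d : nat -> K).
Context (dP : forall x (e : R), 0 < e -> exists k, nrm (x - d k) < e).

(** Otherwise some [d k] is closer to [u] than [nrm u], while orthogonality makes the distance at
    least [nrm u]. *)
Lemma dense_eq0 u : (forall k, rin u (d k) = 0) -> u = 0.
Proof.
move=> ud; apply: nrm_eq0; apply/eqP; apply: contraT => u0.
have u1 : 0 < nrm u by rewrite lt_neqAle eq_sym u0 nrm_ge0.
have [k uk] := dP u u1.
have : nrm (u - d k) ^+ 2 < nrm u ^+ 2 by rewrite ltr_pXn2r ?nnegrE ?nrm_ge0.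
by rewrite nrmB2 ud mulr0 subr0 gtrDl ltNge sqr_ge0.
Qed.

(** This turns a norm bound into countably many scalar conditions, as measurability requires. *)
Lemma nrm_le_dense u (t : R) : 0 <= t ->
  (nrm u <= t) <-> (forall k, rin u (d k) <= t * nrm (d k)).
Proof.
move=> t0; split => [ut k|h].
  by rewrite (le_trans (rin_le _ _))// ler_wpM2r ?nrm_ge0.
apply/ler_addgt0Pr => e e0.
have [->|u0] := eqVneq (nrm u) 0; first by rewrite addr_ge0// ltW.
have u1 : 0 < nrm u by rewrite lt_neqAle eq_sym u0 nrm_ge0.
(* With this precision, replacing one [u] in [rin u u] by [d k], and [nrm (d k)] by [nrm u], costs
   at most [e * nrm u] in total. *)
have et : 0 < e * nrm u / (t + nrm u) by rewrite divr_gt0 ?mulr_gt0// ltr_wpDl.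
have [k uk] := dP u et.
have ku := nrmD (d k - u) u; rewrite subrK nrmC in ku.
have : nrm u ^+ 2 <= (t + e) * nrm u.
  rewrite -rinxx -[X in rin _ X](subrK (d k)) rinDr.
  have := rin_le u (u - d k); have := h k.
  have ku' : t * nrm (d k) <= t * (nrm (u - d k) + nrm u) by rewrite ler_wpM2l.
  have : nrm (u - d k) * (t + nrm u) <= e * nrm u.
    by rewrite -ler_pdivlMr ?ltr_wpDl// ltW.
  lra.
by rewrite expr2 ler_pM2r.
Qed.

Lemma measurable_le_cst (f : measurableTypeR R -> R) (t : R) :
  measurable_fun setT f -> measurable [set s | f s <= t].
Proof.
move=> mf; rewrite (_ : [set _ | _] = setT `&` f @^-1` `]-oo, t]); first exact: mf.
by rewrite setTI; apply/seteqP; split => s /=; rewrite in_itv.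
Qed.

Lemma measurable_funP_ge (f : measurableTypeR R -> R) :
  (forall t, measurable [set s | t <= f s]) -> measurable_fun setT f.
Proof.
move=> mf mT; apply: (measurability _ (measurable_realfun.RGenCInfty.measurableE R)) => //.
move=> /= _ [_ [r ->] <-].
rewrite setTI (_ : _ @^-1` _ = [set s | r <= f s])//.
by apply/seteqP; split => s /=; rewrite in_itv /= andbT.
Qed.

Lemma measurable_nrm (F : measurableTypeR R -> K) :
  (forall y, measurable_fun setT (fun s => rin (F s) y)) ->
  measurable_fun setT (fun s => nrm (F s)).
Proof.
move=> mF.
(* The double negation turns the sublevel sets, which [nrm_le_dense] describes, into the superlevel
   sets expected by [measurable_funP_ge]. *)
rewrite (_ : (fun s => _) = (fun s => - (- nrm (F s)))); last first.
  by apply/funext => s; rewrite opprK.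
apply: measurableT_comp => //; apply: measurable_funP_ge => t.
rewrite (_ : [set s | _] = [set s | nrm (F s) <= - t]); last first.
  by apply/seteqP; split => s /=; rewrite lerNr.
have [t0|t0] := ltP (- t) 0.
  rewrite (_ : [set _ | _] = set0)//; apply/seteqP; split => s //=.
  by rewrite leNgt (lt_le_trans t0)// nrm_ge0.
rewrite (_ : [set _ | _] = \bigcap_k [set s | rin (F s) (d k) <= - t * nrm (d k)]).
  apply: bigcap_measurable => // k _.
  exact: measurable_le_cst (mF (d k)).
apply/seteqP; split => s /=.
  by move=> /(nrm_le_dense _ t0) h k _; exact: h.
by move=> h; apply/(nrm_le_dense _ t0) => k; exact: h.
Qed.

End Separable.

Lemma null_cover {d} {T : measurableType d} {R : realType} (m : {measure set T -> \bar R})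
    (I : countType) (Y : I -> set T) :
  (forall i, measurable (Y i)) -> (forall i, m (Y i) = 0%E) ->
  exists Z, [/\ measurable Z, m Z = 0%E & forall i, Y i `<=` Z].
Proof.
move=> mY Y0; pose F n := if unpickle n is Some i then Y i else set0.
have mF n : measurable (F n) by rewrite /F; case: unpickle.
exists (\bigcup_n F n); split.
- exact: bigcup_measurable.
- apply/eqP; rewrite eq_le measure_ge0 andbT.
  rewrite (le_trans (measure_sigma_subadditive m mF _ (@subset_refl _ _)))//.
    exact: bigcup_measurable.
  rewrite eseries0// => n _ _; rewrite /F; case: unpickle => //.
- by move=> i t Yt; exists (pickle i) => //; rewrite /F pickleK.
Qed.

(** * Pointwise orthogonality of the two densities through [G] *)

Section DensityOrthogonality.
Context {R : realType} {H K : hilbertType R} (sepK : separable K).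
Context {A : boundedOp H H} {B : boundedOp K H} {G : boundedOp K K}.
Context {E EG : opMeasure H} (selfA : selfadjoint A) (selfG : selfadjoint G).
Context (specE : spectral_measure A E).
Context (specEG : spectral_measure (A \+ (B \o G \o adj B)) EG).
Context {W W' : measurableTypeR R -> boundedOp K K}.
Context {m m' : {measure set (measurableTypeR R) -> \bar R}}.
Context (dM : has_density (compress B E) W m) (dMG : has_density (compress B EG) W' m').

Lemma density_nrm_measurable (M : opMeasure K) (V : measurableTypeR R -> boundedOp K K)
    (p : {measure set (measurableTypeR R) -> \bar R}) x a :
  has_density M V p -> measurable_fun setT (fun s => nrm (V s x - a)).
Proof.
move=> [wV _ _]; have [d dP] := dense_sequence sepK.
apply: (measurable_nrm dP) => y.
under eq_fun do rewrite rinBl.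
by apply: measurable_realfun.measurable_funB => //; case: (wV x y).
Qed.

(** Countably many pieces of [S] have almost constant densities with a nonzero pairing, and
    [density_piece] covers each of them by two null sets. Any point with a nonzero pairing on the
    dense sequence lies in such a piece. *)
Lemma density_orthogonal (S : set (measurableTypeR R)) :
  measurable S -> lebesgue_measure S = 0%E ->
  exists Y Z, [/\ measurable Y, measurable Z, m Y = 0%E, m' Z = 0%E &
    forall s, S s -> ~ Y s -> ~ Z s -> forall x, W s (G (W' s x)) = 0].
Proof.
move=> mS S0; have [d dP] := dense_sequence sepK.
have [g g0 hG] := nrm_bound G.
pose eta (n : nat) : R := n.+1%:R^-1.
have eta0 n : 0 < eta n by rewrite invr_gt0.
pose I := (nat * nat * nat * nat * nat)%type.
(* In an index, [j] and [k] select the test vectors, [l] and [p] the approximate values, and [n]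
   both the precision and the bound on the two forms. *)
pose X (i : I) := let: (j, k, l, p, n) := i in S `&`
  ([set s | nrm (W s (d j) - d l) <= eta n] `&` [set s | nrm (W' s (d k) - d p) <= eta n]
   `&` ([set s | rin (W s (d j)) (d j) <= n%:R] `&` [set s | rin (W' s (d k)) (d k) <= n%:R])).
pose gap (i : I) := let: (j, k, l, p, n) := i in
  g * eta n * (nrm (d l) + nrm (d p) + eta n) < `|rin (G (d l)) (d p)|.
have mX i : measurable (X i).
  case: i => [[[[j k] l] p] n]; apply: measurableI => //.
  have [wW _ _] := dM; have [wW' _ _] := dMG.
  apply: measurableI; apply: measurableI; apply: measurable_le_cst.
  - exact: density_nrm_measurable dM.
  - exact: density_nrm_measurable dMG.
  - by case: (wW (d j) (d j)).
  - by case: (wW' (d k) (d k)).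
have X0 i : lebesgue_measure (X i) = 0%E.
  apply/eqP; rewrite eq_le measure_ge0 andbT -S0; apply: le_measure; rewrite ?inE//.
  by case: i => [[[[j k] l] p] n] s [].
have /choice[Y /choice[Z YZ]] : forall i, exists Y Z, [/\ measurable Y, measurable Z,
    m Y = 0%E, m' Z = 0%E & gap i -> X i `<=` Y `|` Z].
  move=> i; have [gi|gi] := pselect (gap i); last first.
    by exists set0, set0; split => //; rewrite measure0.
  suff [Y [Z [mY mZ Y0 Z0 XYZ]]] : exists Y Z, [/\ measurable Y, measurable Z,
      m Y = 0%E, m' Z = 0%E & X i `<=` Y `|` Z] by exists Y, Z.
  move: (mX i) (X0 i) gi; case: i => [[[[j k] l] p] n] mXi Xi0 gi.
  apply: (density_piece selfA selfG specE specEG dM dMG mXi Xi0 (ler0n _ n)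
    (ltW (eta0 n)) g0 hG gi (x := d j) (y := d k)).
  by move=> s [_ [[? ?] [? ?]]].
have [Y' [mY' Y'0 YY']] := @null_cover _ _ _ m _ Y (fun i => let: And5 h _ _ _ _ := YZ i in h)
  (fun i => let: And5 _ _ h _ _ := YZ i in h).
have [Z' [mZ' Z'0 ZZ']] := @null_cover _ _ _ m' _ Z (fun i => let: And5 _ h _ _ _ := YZ i in h)
  (fun i => let: And5 _ _ _ h _ := YZ i in h).
exists Y', Z'; split => // s Ss nY nZ.
have [_ W0 _] := dM; have [_ W'0 _] := dMG.
have sW := selfadjoint_rin (positive_selfadjoint (W0 s)).
have sW' := selfadjoint_rin (positive_selfadjoint (W'0 s)).
have sG := selfadjoint_rin selfG.
suff ortho j k : rin (G (W s (d j))) (W' s (d k)) = 0.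
  have WG j : W' s (G (W s (d j))) = 0 by apply: (dense_eq0 dP) => k; rewrite sW' ortho.
  by move=> x; apply: (dense_eq0 dP) => j; rewrite sW sG sW' WG rin0r.
apply/eqP/negPn/negP => fh0.
set f := W s (d j) in fh0; set h := W' s (d k) in fh0.
have t0 : 0 < `|rin (G f) h| by rewrite normr_gt0.
(* The 3 allows 1 for each of [nrm (d l) - nrm f], [nrm (d p) - nrm h] and [eta n]. *)
pose q := nrm f + nrm h + 3.
have q0 : 0 < q by rewrite ltr_wpDl// addr_ge0 ?nrm_ge0.
have c1 : 0 <= rin f (d j) by exact: positive_op_rin.
have c2 : 0 <= rin h (d k) by exact: positive_op_rin.
(* An [n] above [T] exceeds both forms and makes [2 * g * eta n * q] smaller than |<G f, h>| (real
   part). *)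
pose T := 2 * g * q / `|rin (G f) h| + rin f (d j) + rin h (d k).
have T1 : 0 <= 2 * g * q / `|rin (G f) h|.
  by rewrite divr_ge0// ?mulr_ge0// ltW.
have [n nT] : exists n : nat, T < n%:R by exists (Num.truncn T).+1; exact: truncnS_gt.
have [l fl] := dP f _ (eta0 n); have [p hp] := dP h _ (eta0 n).
have eta1 : eta n <= 1 by rewrite invf_le1// ler1n.
have etaq : 2 * g * eta n * q < `|rin (G f) h|.
  have : 2 * g * q / `|rin (G f) h| < n.+1%:R.
    by rewrite (le_lt_trans _ (lt_le_trans nT _)) ?ler_nat// /T -addrA lerDl addr_ge0//.
  rewrite ltr_pdivrMr// => h1; rewrite (_ : _ * q = 2 * g * q / n.+1%:R).
    by rewrite ltr_pdivrMr// [X in _ < X]mulrC.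
  by rewrite /eta mulrAC.
have Gle u v : `|rin (G u) v| <= g * nrm u * nrm v.
  by rewrite (le_trans (CauchySchwarz_rin _ _))// ler_wpM2r ?nrm_ge0.
have lf : nrm (d l) <= nrm f + 1.
  by have := nrmD (d l - f) f; rewrite subrK nrmC; move: fl eta1; lra.
have ph : nrm (d p) <= nrm h + 1.
  by have := nrmD (d p - h) h; rewrite subrK nrmC; move: hp eta1; lra.
have ge0 : 0 < g * eta n by rewrite mulr_gt0.
have gi : gap (j, k, l, p, n).
  rewrite /gap; apply: (@le_lt_trans _ _ (g * eta n * q)).
    by rewrite ler_wpM2l ?(ltW ge0)// /q; lra.
  (* Passing from [f], [h] to [d l], [d p] costs at most [g * eta n * q], half of what [etaq]
     allows; the other half is the gap. *)
  have e1 : `|rin (G f) h| <= `|rin (G (d l)) (d p)| + g * eta n * q.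
    rewrite (_ : rin (G f) h = rin (G (d l)) (d p) + (rin (G (f - d l)) (d p)
       + rin (G f) (h - d p))); last by rewrite linearB /= rinBl rinBr; ring.
    rewrite (le_trans (ler_normD _ _))// lerD2l (le_trans (ler_normD _ _))//.
    have h1 : `|rin (G (f - d l)) (d p)| <= g * eta n * (nrm h + 1).
      rewrite (le_trans (Gle _ _))// ler_pM ?mulr_ge0 ?nrm_ge0// ?(ltW g0)//.
      by rewrite ler_wpM2l// ltW.
    have h2 : `|rin (G f) (h - d p)| <= g * eta n * nrm f.
      rewrite (le_trans (Gle _ _))// -!mulrA ler_wpM2l ?(ltW g0)//.
      by rewrite mulrC ler_wpM2r ?nrm_ge0// ltW.
    by move: h1 h2 ge0; rewrite /q; nra.
  by move: etaq e1; lra.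
have Xs : X (j, k, l, p, n) s.
  split=> //; split; split => /=; [exact: ltW|exact: ltW| |].
  - by apply/ltW/(le_lt_trans _ nT); rewrite /T -/f; lra.
  - by apply/ltW/(le_lt_trans _ nT); rewrite /T -/h; lra.
case: (YZ (j, k, l, p, n)) => _ _ _ _ /(_ gi s Xs)[/YY'|/ZZ'] //.
Qed.

End DensityOrthogonality.

(** * The orthogonal projection onto the kernel of a self-adjoint operator *)

Section KernelProjection.
Context {R : realType} {K : hilbertType R}.
Local Open Scope complex_scope.

Lemma nrm_cauchy_limit (u : nat -> K) :
  (forall e : R, 0 < e -> exists N, forall n m, (N <= n)%N -> (N <= m)%N ->
    nrm (u n - u m) < e) ->
  exists p, forall e : R, 0 < e -> exists N, forall n, (N <= n)%N -> nrm (p - u n) < e.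
Proof.
move=> uC; have ucvg : cvg (u @ \oo).
  apply/cauchy_cvgP/cauchy_exP => eps eps0.
  have epsE : eps = (complex.Re eps)%:C by rewrite RRe_real // gtr0_real.
  have [N hN] := uC (complex.Re eps) ltac:(by rewrite -ltcR -epsE).
  exists (u N), N => // n /= Nn; rewrite -ball_normE /= epsE nrmE ltcR.
  exact: hN.
exists (lim (u @ \oo)) => e e0.
have /cvgrPdist_lt/(_ e%:C) : u @ \oo --> lim (u @ \oo) by [].
rewrite ltcR => /(_ e0)[N _ hN]; exists N => n Nn.
by have := hN n Nn; rewrite nrmE ltcR.
Qed.

Context (W : boundedOp K K).

(** For self-adjoint [W] this is the orthogonal complement of the kernel. The explicit approximants
    [W v] serve later for measurability. *)
Definition closure_range (z : K) := forall e : R, 0 < e -> exists v, nrm (z - W v) < e.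

Lemma closure_range_orthogonal p z :
  (forall v, rin p (W v) = 0) -> closure_range z -> rin p z = 0.
Proof.
move=> pW zW; apply/eqP; rewrite -normr_le0; apply/ler_addgt0Pr => e e0.
rewrite add0r; have [v zv] := zW (e / (nrm p + 1)) ltac:(by rewrite divr_gt0 ?ltr_wpDl ?nrm_ge0).
rewrite -[z](subrK (W v)) rinDr pW addr0 (le_trans (CauchySchwarz_rin _ _))//.
move: zv; rewrite ltr_pdivlMr ?ltr_wpDl ?nrm_ge0// => zv.
by apply: le_trans (ltW zv); rewrite mulrC ler_wpM2l ?nrm_ge0// lerDl.
Qed.

(** The residuals x - W v of a minimizing sequence converge by the parallelogram law. Their limit
    [p] has minimal norm, so varying it along the range shows that it is orthogonal to the range. *)
Lemma closest_point x :
  exists p, (forall v, rin p (W v) = 0) /\ closure_range (x - p).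
Proof.
pose S := [set nrm (x - W v) | v in [set: K]].
have infS : has_inf S.
  by split; [exists (nrm (x - W 0)); exists 0|exists 0 => _ [v _ <-]; exact: nrm_ge0].
set d := inf S in infS *.
have dle v : d <= nrm (x - W v) by apply: ge_inf; [case: infS|exists v].
have d0 : 0 <= d by apply: lb_le_inf; [case: infS|move=> _ [v _ <-]; exact: nrm_ge0].
have /choice[v vP] n : exists v, nrm (x - W v) < d + n.+1%:R^-1.
  have [_ [v _ <-] vd] := @inf_adherent _ S n.+1%:R^-1 ltac:(by rewrite invr_gt0) infS.
  by exists v.
pose u n := x - W (v n).
have small (e : R) : 0 < e -> exists N, forall n, (N <= n)%N -> nrm (u n) <= d + e.
  move=> e0; exists (Num.truncn e^-1) => n Nn.
  apply: le_trans (ltW (vP n)) _; rewrite lerD2l -[e]invrK lef_pV2 ?posrE ?invr_gt0//.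
  by apply: ltW; rewrite (lt_le_trans (truncnS_gt _))// ler_nat ltnS.
(* The midpoint of two residuals is a residual, so its norm is at least [d]; and 4 (d + e)^2 - (2
   d)^2 is at most (8 d + 4) e when e <= 1. *)
have par n m (e : R) : 0 < e -> e <= 1 -> nrm (u n) <= d + e -> nrm (u m) <= d + e ->
    nrm (u n - u m) ^+ 2 <= (8 * d + 4) * e.
  move=> e0 e1 hn hm.
  have h : 2 * d <= nrm (u n + u m).
    have := dle ((2^-1)%:C *: (v n + v m)).
    rewrite linearZ linearD /= (_ : x - _ = (2^-1)%:C *: (u n + u m)).
      by rewrite nrmZ ger0_norm ?invr_ge0// ler_pdivlMl.
    rewrite /u addrACA -opprD [in RHS]scalerBr; congr (_ - _).
    rewrite -[x in RHS]scale1r -scalerDl scalerA -(rmorph1 (real_complex R)).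
    rewrite -rmorphD -rmorphM /=.
    by rewrite mulVf ?scale1r// (_ : 1 + 1 = 2)// pnatr_eq0.
  have : nrm (u n - u m) ^+ 2 = 2 * nrm (u n) ^+ 2 + 2 * nrm (u m) ^+ 2 - nrm (u n + u m) ^+ 2.
    by rewrite (nrmB2 (u n)) (nrmD2 (u n)); ring.
  have hn2 : nrm (u n) ^+ 2 <= (d + e) ^+ 2
    by rewrite ler_pXn2r ?nnegrE ?nrm_ge0// addr_ge0// ltW.
  have hm2 : nrm (u m) ^+ 2 <= (d + e) ^+ 2
    by rewrite ler_pXn2r ?nnegrE ?nrm_ge0// addr_ge0// ltW.
  have h2 : (2 * d) ^+ 2 <= nrm (u n + u m) ^+ 2
    by rewrite ler_pXn2r ?nnegrE ?nrm_ge0// mulr_ge0.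
  by nra.
have [|p pP] := @nrm_cauchy_limit u.
  (* The 5 in place of the 4 of [par] makes the final inequality strict. *)
  move=> e e0; pose e' := Num.min 1 (e ^+ 2 / (8 * d + 5)).
  have k0 : 0 < 8 * d + 5 by lra.
  have e'0 : 0 < e' by rewrite lt_min ltr01 divr_gt0 // exprn_gt0.
  have [N hN] := small _ e'0; exists N => n m /hN hn /hN hm.
  have e'1 : e' <= 1 by rewrite ge_min lexx.
  have := par _ _ _ e'0 e'1 hn hm.
  have : (8 * d + 5) * e' <= e ^+ 2 by rewrite mulrC -ler_pdivlMr // ge_min lexx orbT.
  move=> h1 h2; rewrite -(ltr_pXn2r (n := 2)) ?nnegrE ?nrm_ge0 ?(ltW e0)//.
  by nra.
exists p; split; last first.
  by move=> e /pP[N /(_ N (leqnn N)) hN]; exists (v N); rewrite addrAC nrmC.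
have pd : nrm p <= d.
  apply/ler_addgt0Pr => e e0.
  have [N hN] := small _ (divr_gt0 e0 (ltr0Sn _ 1)).
  have [N' hN'] := pP _ (divr_gt0 e0 (ltr0Sn _ 1)).
  have := nrmD (p - u (maxn N N')) (u (maxn N N')); rewrite subrK.
  have := hN (maxn N N') (leq_maxl _ _); have := hN' (maxn N N') (leq_maxr _ _); lra.
move=> w.
have dp (t : R) : d <= nrm (p - t%:C *: W w).
  apply/ler_addgt0Pr => e /pP[N /(_ N (leqnn N)) hN].
  have := dle (v N + t%:C *: w); rewrite linearD linearZ /= opprD addrA -/(u N) => h.
  have := nrmD (p - t%:C *: W w) (u N - p).
  rewrite (_ : _ + (u N - p) = u N - t%:C *: W w); last by rewrite addrC addrA subrK.
  by rewrite [nrm (u N - p)]nrmC; move: h hN; lra.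
have dp2 (t : R) : 0 <= - (2 * (t * rin p (W w))) + t ^+ 2 * nrm (W w) ^+ 2.
  have : nrm p ^+ 2 <= nrm (p - t%:C *: W w) ^+ 2.
    by rewrite ler_pXn2r ?nnegrE ?nrm_ge0// (le_trans pd).
  rewrite nrmB2 rinZr nrmZ exprMn real_normK ?num_real//; lra.
have [w0|w0] := eqVneq (nrm (W w)) 0; first by rewrite (nrm_eq0 w0) rin0r.
(* This is the minimizer of the quadratic polynomial in [dp2]. *)
have := dp2 (rin p (W w) / nrm (W w) ^+ 2).
set t := rin p (W w); rewrite expr_div_n.
have -> : - (2 * (t / nrm (W w) ^+ 2 * t)) + t ^+ 2 / nrm (W w) ^+ 2 ^+ 2 * nrm (W w) ^+ 2 =
    - (t ^+ 2 / nrm (W w) ^+ 2) by field.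
rewrite oppr_ge0 pmulr_lle0 ?invr_gt0 ?exprn_even_gt0//.
by move=> t0; apply/eqP; rewrite -sqrf_eq0 eq_le t0 sqr_ge0.
Qed.

(** Orthogonality to the range and [closure_range] determine the decomposition of x uniquely;
    linearity and idempotence follow from this uniqueness. *)
Lemma kernel_projection : selfadjoint W ->
  exists P : boundedOp K K, [/\ orthogonal_projection P, forall x, W (P x) = 0
    & forall x, closure_range (x - P x)].
Proof.
move=> /selfadjoint_rin sW; have [P0 P0P] := choice closest_point.
have uniq x p : (forall v, rin p (W v) = 0) -> closure_range (x - p) -> P0 x = p.
  move=> pW xp; apply/subr0_eq/nrm_eq0/eqP; rewrite -sqrf_eq0 -rinxx.
  have [qW xq] := P0P x.
  have dW v : rin (P0 x - p) (W v) = 0 by rewrite rinBl qW pW subrr.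
  rewrite [X in rin _ X](_ : _ = (x - p) - (x - P0 x)); last first.
    by rewrite opprB [RHS]addrC addrA subrK.
  by rewrite rinBr (closure_range_orthogonal dW xp) (closure_range_orthogonal dW xq) subrr.
have P0W x v : rin (P0 x) (W v) = 0 by case: (P0P x).
have Plin : linear P0.
  move=> a x y; apply: uniq => [v|e e0].
    (* [P0W] concerns real parts only; for a complex scalar [a] it is also applied to ['i *: v]. *)
    rewrite rinDl P0W addr0 /rin linearZl_LR /=.
    have := P0W x v; have := P0W x ('i *: v); rewrite linearZ /= => h1 h2.
    by rewrite (inner_eq0 h2 h1) mulr0.
  have a0 : 0 < complex.Re `|a| + 1 by rewrite ltr_wpDl// -ler0c RRe_real ?normr_real.
  have [v xv] := (P0P x).2 (e / (complex.Re `|a| + 1)) (divr_gt0 e0 a0).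
  have [e2 [h [w yw]]] : exists e2, nrm (a *: (x - P0 x - W v)) < e2 /\
      exists w, nrm (y - P0 y - W w) < e - e2.
    have : nrm (a *: (x - P0 x - W v)) < e.
      have -> : nrm (a *: (x - P0 x - W v)) = complex.Re `|a| * nrm (x - P0 x - W v).
        by apply: complexI; rewrite rmorphM /= !RRe_real ?normr_real// normrZ.
      move: xv; rewrite ltr_pdivlMr// => xv; have := nrm_ge0 (x - P0 x - W v); nra.
    set b := nrm _ => be; exists ((b + e) / 2); split; first lra.
    by apply: (P0P y).2; lra.
  exists (a *: v + w).
  rewrite (_ : _ - W _ = a *: (x - P0 x - W v) + (y - P0 y - W w)).
    by rewrite (le_lt_trans (nrmD _ _))//; lra.
  have -> : W (a *: v + w) = a *: W v + W w by rewrite linearP.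
  rewrite !scalerBr !opprD [RHS]addrACA; congr (_ + _).
  by rewrite addrACA.
pose Pl := GRing.isLinear.Build _ _ _ _ P0 Plin.
pose Pm : {linear K -> K} := HB.pack P0 Pl.
(* The right-hand side is symmetric, which gives self-adjointness; at [y = x] it gives the norm
   bound. *)
have Psplit x y : rin (P0 x) y = rin (P0 x) (P0 y).
  rewrite -[y in LHS](subrK (P0 y)) rinDr.
  by rewrite (closure_range_orthogonal (P0W x) (P0P y).2) add0r.
have Pnrm x : nrm (Pm x) <= 1 * nrm x.
  rewrite mul1r /=; have := rin_le (P0 x) x; rewrite Psplit rinxx.
  have [->|p0] := eqVneq (nrm (P0 x)) 0; first by rewrite nrm_ge0.
  by rewrite expr2 ler_pM2l// lt_neqAle eq_sym p0 nrm_ge0.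
exists (BoundedOp (nrm_continuous ltr01 Pnrm)); split => [|x|x] /=.
- split => [|x] /=.
    by apply: rin_selfadjoint => x y /=; rewrite Psplit rinC -Psplit rinC.
  by apply: uniq => // e e0; exists 0; rewrite linear0 !subrr nrm0.
- by apply: rin_inj => z; rewrite rin0r rinC sW P0W.
- by case: (P0P x).
Qed.

End KernelProjection.

(** * From pointwise orthogonal densities to vector mutual singularity *)

Section MutualSingularity.
Context {R : realType} {K : hilbertType R} (sepK : separable K).
Local Notation borel := (set (measurableTypeR R)).
Local Open Scope complex_scope.
Implicit Types W P : measurableTypeR R -> boundedOp K K.

Lemma weakly_measurable_rin W :
  weakly_measurable W <-> forall x y, measurable_fun setT (fun s => rin (W s x) y).
Proof.
split => [wW x y|mW x y]; first by case: (wW x y).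
by split; [exact: mW|under eq_fun do rewrite Im_inner; exact: mW].
Qed.

(** [P x] is orthogonal to [W v], so |P x|^2 is the real part of <P x, x - W v>. *)
Lemma kernel_projection_nrm (W P : boundedOp K K) x v : selfadjoint W ->
  orthogonal_projection P -> (forall x, W (P x) = 0) -> nrm (P x) <= nrm (x - W v).
Proof.
move=> /selfadjoint_rin sW [/selfadjoint_rin sP PP] WP.
have : nrm (P x) ^+ 2 <= nrm (P x) * nrm (x - W v).
  apply: le_trans (rin_le _ _).
  by rewrite rinBr -[rin _ (W v)]sW WP rin0l subr0 -[in leRHS]PP sP rinxx.
have [->|p0] := eqVneq (nrm (P x)) 0; first by rewrite nrm_ge0.
by rewrite expr2 ler_pM2l// lt_neqAle eq_sym p0 nrm_ge0.
Qed.

(* |P x| is the infimum of |x - W d_k| over a dense sequence d. *)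
Lemma weakly_measurable_kernel_projection W P : weakly_measurable W ->
  (forall s, selfadjoint (W s)) -> (forall s, orthogonal_projection (P s)) ->
  (forall s x, W s (P s x) = 0) -> (forall s x, closure_range (W s) (x - P s x)) ->
  weakly_measurable P.
Proof.
move=> /weakly_measurable_rin mW sW oP WP cP; have [d dP] := dense_sequence sepK.
have mN x : measurable_fun setT (fun s => nrm (P s x)).
  apply: measurable_funP_ge => t.
  rewrite (_ : [set s | _] = \bigcap_k [set s | t <= nrm (x - W s (d k))]).
    apply: bigcap_measurable => // k _.
    have mk : measurable_fun setT (fun s => - nrm (x - W s (d k))).
      apply: measurableT_comp => //; apply: (measurable_nrm dP) => y.
      under eq_fun do rewrite rinBl.
      by apply: measurable_realfun.measurable_funB.
    have := measurable_le_cst (- t) mk; congr (measurable _).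
    by apply/seteqP; split => s /=; rewrite lerN2.
  apply/seteqP; split => s /= h.
    by move=> k _ /=; rewrite (le_trans h)// kernel_projection_nrm.
  apply/ler_addgt0Pr => e e0.
  have e2 : 0 < e / 2 by rewrite divr_gt0.
  have [v xv] := cP s x _ e2.
  have [C C0 WC] := nrm_bound (W s).
  have [k vk] := dP v _ (divr_gt0 e2 C0).
  have : t <= nrm (x - W s (d k)) by exact: h.
  rewrite (_ : x - _ = P s x + ((x - P s x - W s v) + W s (v - d k))).
    have := nrmD (P s x) ((x - P s x - W s v) + W s (v - d k)).
    have := nrmD (x - P s x - W s v) (W s (v - d k)).
    have : nrm (W s (v - d k)) < e / 2.
      by apply: le_lt_trans (WC _) _; rewrite mulrC -ltr_pdivlMr.
    by move: xv; lra.
  by rewrite (linearB (W s)) /= [X in _ = _ + X]addrA subrK addrA [P s x + _]addrC subrK.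
apply/weakly_measurable_rin => x y.
(* Polarization: for a projection, |P z|^2 is the quadratic form at z. *)
rewrite (_ : (fun s => _) =
    (fun s => 4^-1 * (nrm (P s (x + y)) ^+ 2 - nrm (P s (x - y)) ^+ 2))).
  by apply: measurable_realfun.measurable_funM => //; apply: measurable_realfun.measurable_funB;
    apply: measurable_realfun.measurable_funX.
apply/funext => s; have [/selfadjoint_rin sP PP] := oP s.
have E z : nrm (P s z) ^+ 2 = rin (P s z) z by rewrite -rinxx -sP PP.
rewrite !E linearB linearD /= rinBl rinDl !rinBr !rinDr (sP y x) (rinC y).
by field.
Qed.

Lemma is_weak_integral0 (F : measurableTypeR R -> K -> K)
    (p : {measure set (measurableTypeR R) -> \bar R}) :
  (forall s x, F s x = 0) -> is_weak_integral (fun=> \0) F p.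
Proof.
move=> F0 X mX x y.
rewrite (_ : (fun s => inner _ _) = (fun=> 0)); last first.
  by apply/funext => s; rewrite F0 linear0l.
split; [exact: integrable0|exact: integrable0|].
by rewrite /= linear0l /Rintegral integral0.
Qed.

(** Let [P s] project onto the kernel of [W s]. Then [W s] kills its range, while the complement
    maps into the closed range of [W s], on which [W' s] vanishes by continuity, since W' W is the
    adjoint of W W'. *)
Lemma orthogonal_densities_singular (M N : opMeasure K) W W'
    (m m' : {measure set (measurableTypeR R) -> \bar R}) :
  has_density M W m -> has_density N W' m' ->
  (forall s x, W s (W' s x) = 0) -> vector_mutually_singular M N.
Proof.
move=> dM dN WW'; have [wW W0 _] := dM; have [_ W'0 _] := dN.
have sW s := positive_selfadjoint (W0 s).
have sW' s := positive_selfadjoint (W'0 s).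
have [P PP] := choice (fun s => kernel_projection (sW s)).
have oP s : orthogonal_projection (P s) by case: (PP s).
have W'P s x : W' s (x - P s x) = 0.
  have W'W v : W' s (W s v) = 0.
    apply: rin_inj => y; rewrite rin0r -(selfadjoint_rin (sW' s)).
    by rewrite -(selfadjoint_rin (sW s)) WW' rin0l.
  have [C C0 W'C] := nrm_bound (W' s).
  apply/nrm_eq0/eqP; rewrite eq_le nrm_ge0 andbT; apply/ler_addgt0Pr => e e0.
  have [_ _ /(_ x _ (divr_gt0 e0 C0))[v xv]] := PP s.
  rewrite add0r -[_ - P s x](subrK (W s v)) linearD /= W'W addr0.
  by rewrite (le_trans (W'C _))// mulrC -ler_pdivlMr// ltW.
split; [by exists W, m|by exists W', m'|].
exists P; split => //.
- by apply: (weakly_measurable_kernel_projection wW) => // s x; case: (PP s).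
- exists W, m; split => //; apply: is_weak_integral0 => s x /=.
  by have [_ -> _] := PP s; rewrite linear0.
- exists W', m'; split => //; apply: is_weak_integral0 => s x /=.
  by rewrite W'P linear0.
Qed.

End MutualSingularity.

(** * Densities of restricted and compressed measures *)

Section DensityTransforms.
Context {R : realType}.
Local Notation borel := (set (measurableTypeR R)).
Local Open Scope complex_scope.

Lemma is_weak_integral_rin {K : hilbertType R} (N : borel -> K -> K)
    (F : measurableTypeR R -> K -> K)
    (m : {measure set (measurableTypeR R) -> \bar R}) :
  (forall X, measurable X -> forall x y,
    m.-integrable X (EFin \o (fun s => rin (F s x) y)) /\
    rin (N X x) y = Rintegral m X (fun s => rin (F s x) y)) ->
  is_weak_integral N F m.
Proof.
move=> h X mX x y; have [i1 r1] := h X mX x y; have [i2 r2] := h X mX x ('i *: y).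
have Im_fun : (fun s => complex.Im '[F s x, y]) = (fun s => rin (F s x) ('i *: y)).
  by apply/funext => s; rewrite Im_inner.
split => //.
  by rewrite (_ : (fun s => _) = EFin \o (fun s => rin (F s x) ('i *: y)))// -Im_fun.
by rewrite Im_fun -r2 -r1 -Im_inner /rin; case: '[N X x, y].
Qed.

Context {K : hilbertType R}.
Implicit Type W : measurableTypeR R -> boundedOp K K.

Definition null_op : boundedOp K K :=
  @BoundedOp R K K \0 (@cst_continuous _ _ (0 : K)).

Definition restrict_density W (D : borel) s := if s \in D then W s else null_op.

Lemma rin_restrict_density W D x y :
  (fun s => rin (restrict_density W D s x) y) = (fun s => rin (W s x) y) \_ D.
Proof.
by apply/funext => s; rewrite /restrict_density patchE; case: ifP => // _; rewrite rin0l.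
Qed.

(** Letting [D] be smaller than [S] by a null set allows exceptional points to be removed, so that
    orthogonality holds at every point and not only almost everywhere. *)
Lemma has_density_restrict (M M' : opMeasure K) W m (S D : borel) :
  has_density M W m -> (forall X x, M' X x = M (X `&` S) x) ->
  measurable S -> measurable D -> D `<=` S -> m (S `\` D) = 0%E ->
  has_density M' (restrict_density W D) m.
Proof.
move=> dM M'E mS mD DS SD0; have [/weakly_measurable_rin mW W0 _] := dM; split.
- apply/weakly_measurable_rin => x y; rewrite rin_restrict_density.
  by apply: (measurable_restrictT _ mD).1; apply: measurable_funTS; exact: mW.
- move=> s x; rewrite /restrict_density; case: ifP => _; first exact: W0.
  by rewrite /= linear0l.
- apply: is_weak_integral_rin => X mX x y; rewrite rin_restrict_density; split.
    apply: (integrableS (E := setT)) => //; rewrite -restrict_EFin.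
    by apply/(integrable_mkcond _ mD).1/(density_integrable dM).
  rewrite M'E (density_rin dM); last exact: measurableI.
  rewrite -Rintegral_mkcondr /Rintegral.
  rewrite (@negligible_integral _ _ _ _ (X `&` S) (S `\` D))//.
  + congr (fine (integral _ _ _)); apply/seteqP; split => s /=.
      by move=> [[Xs Ss] nSD]; split=> //; apply: contrapT => nD; exact: nSD.
    by move=> [Xs Ds]; split; [split => //; exact: DS|case].
  + exact: measurableD.
  + exact: measurableI.
  + by apply: (density_integrable dM); exact: measurableI.
Qed.

(** For self-adjoint [G] this gives the density G W G of the measure G M G. *)
Lemma has_density_compress (G : boundedOp K K) (M : opMeasure K) W m :
  has_density M W m ->
  has_density (compress G M) (fun s => op_comp (adj G) (op_comp (W s) G)) m.
Proof.
move=> dM; have [/weakly_measurable_rin mW W0 _] := dM.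
have E (T : boundedOp K K) x y : rin (adj G (T (G x))) y = rin (T (G x)) (G y).
  by rewrite rinC -adj_rin rinC.
split.
- apply/weakly_measurable_rin => x y /=.
  by under eq_fun do rewrite E; exact: mW.
- by move=> s x /=; rewrite innerC -adjP -innerC; exact: W0.
- apply: is_weak_integral_rin => X mX x y /=; rewrite E.
  under [X in _ /\ _ = Rintegral _ _ X]eq_fun do rewrite E.
  under [X in integrable _ _ X]eq_fun do rewrite /= E.
  by split; [exact: (density_integrable dM)|exact: (density_rin dM)].
Qed.

End DensityTransforms.

Theorem theorem8p2 (R : realType) (H K : hilbertType R)
    (sepH : separable H) (sepK : separable K)
    (A : boundedOp H H) (selfA : selfadjoint A)
    (B : boundedOp K H)
    (G : boundedOp K K) (selfG : selfadjoint G)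
    (E EG : opMeasure H)
    (specE : spectral_measure A E)
    (specEG : spectral_measure (A \+ (B \o G \o adj B)) EG)
    (wM : weak_indefinite_integral (compress B E))
    (wMG : weak_indefinite_integral (compress B EG))
    (S SG : set (measurableTypeR R))
    (cS : singular_carrier E S) (cSG : singular_carrier EG SG) :
  let Ms := compress B (singular_part cS) in
  let MGs := compress B (singular_part cSG) in
  vector_mutually_singular Ms (compress G MGs) /\
  vector_mutually_singular (compress G Ms) MGs.
Proof.
move=> Ms MGs; have [W [m dM]] := wM; have [W' [m' dMG]] := wMG.
have [mS S0 _] := cS; have [mSG _ _] := cSG.
have [Y [Z [mY mZ Y0 Z0 YZ]]] :=
  density_orthogonal sepK selfA selfG specE specEG dM dMG mS S0.
have null (p : {measure set (measurableTypeR R) -> \bar R}) (X N : set (measurableTypeR R)) :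
    measurable X -> measurable N -> p N = 0%E -> p (X `\` (X `\` N)) = 0%E.
  move=> mX mN N0; apply/eqP; rewrite eq_le measure_ge0 andbT -N0.
  apply: le_measure; rewrite ?inE//; first by do 2!apply: measurableD => //.
  by move=> s [Xs nXN]; apply: contrapT => Ns; exact: nXN.
(* Removing [Y] and [Z] from the two carriers leaves only points where [density_orthogonal] applies
   or one density is zero. *)
have dMs : has_density Ms (restrict_density W (S `\` Y)) m.
  by apply: (has_density_restrict dM _ mS) => //;
    [exact: measurableD|exact: (null _ _ _ mS mY)].
have dMGs : has_density MGs (restrict_density W' (SG `\` Z)) m'.
  by apply: (has_density_restrict dMG _ mSG) => //;
    [exact: measurableD|exact: (null _ _ _ mSG mZ)].
have WGW' s x : restrict_density W (S `\` Y) s (G (restrict_density W' (SG `\` Z) s x)) = 0.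
  rewrite /restrict_density; case: ifPn => [/set_mem[Ss nYs]|_//].
  by case: ifPn => [/set_mem[_ nZs]|_]; [exact: YZ|rewrite /= !linear0].
split.
- apply: (orthogonal_densities_singular sepK dMs (has_density_compress G dMGs)) => s x /=.
  by rewrite selfadjoint_adj// WGW'.
- apply: (orthogonal_densities_singular sepK (has_density_compress G dMs) dMGs) => s x /=.
  by rewrite WGW' linear0.
Qed.
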